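(* Suppose the regularity conditions (R), the terminal conditions (T) and incremental stabilizability (IS) stated in the context hold. Then, for any $\lambda>0$, the closed-loop system $x(k+1)=f(x(k),u(k))+w(k)$, $u(k)=\pi_{\mathrm{input}}(x(k))$, $x(0)=x_0$, is ISS with the continuous ISS Lyapunov function $V_{\mathrm{slack}}$. Suppose further that the simplifying conditions (E) and the feedback condition (L) stated in the context hold. Then there exist constants $c_{\mathbb{X},\mathbb{U},i}\ge0$, $i\in\mathbb{I}_{[1,3]}$, such that for any initial condition $x_0\in\mathbb{R}^n$, weight $\lambda>0$, disturbances $w(k)\in\mathbb{R}^n$, $k\in\mathbb{I}_{\ge0}$, and any time $T\in\mathbb{I}_{\ge0}$, the closed-loop system satisfies $$\sum_{k=0}^{T-1}\big(\|x(k)\|_{\mathbb{X}}^2+\|u(k)\|_{\mathbb{U}}^2\big)\le c_{\mathbb{X},\mathbb{U},1}\|x_0\|_{\mathbb{X}_N}^2+\frac{c_{\mathbb{X},\mathbb{U},2}}{\lambda}+c_{\mathbb{X},\mathbb{U},3}\sum_{k=0}^{T-1}\|w(k)\|^2 .$$ Furthermore, for any $x_0\in\mathbb{X}_N$ (and any $\lambda>0$, disturbances $w(k)\in\mathbb{R}^n$, and $T\in\mathbb{I}_{\ge0}$), the closed-loop system satisfies $$\frac{1}{1+\epsilon_\lambda}\sum_{k=0}^{T-1}\ell(x(k),u(k))\le V_{\mathrm{nom}}(x_0)+\lambda c_{\delta,4}\sum_{k=0}^{T-1}\|w(k)\|^2,\qquad \epsilon_\lambda:=\frac1\lambda\fr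ac{\sigma_{\max}(Q)+c_\kappa^2\sigma_{\max}(R)}{c_{\delta,3}}\in(0,\infty).$$
   Context: Notation. $\|\cdot\|$ is the Euclidean norm; for a positive definite matrix $Q$, $\|x\|_Q=\sqrt{x^\top Qx}$, and $\sigma_{\max}(Q)$ is its maximal eigenvalue; for a set $\mathcal{A}$, $\|x\|_{\mathcal{A}}=\inf_{s\in\mathcal{A}}\|x-s\|$. $\mathbb{I}_{[a,b]}$ (resp. $\mathbb{I}_{\ge a}$) is the set of integers in $[a,b]$ (resp. $\ge a$). $\mathcal{K}$: continuous strictly increasing functions $\alpha:\mathbb{R}_{\ge0}\to\mathbb{R}_{\ge0}$ with $\alpha(0)=0$; $\mathcal{K}_\infty$: radially unbounded functions in $\mathcal{K}$; $\mathcal{KL}$: functions $\beta:\mathbb{R}_{\ge0}\times\mathbb{I}_{\ge0}\to\mathbb{R}_{\ge0}$ with $\beta(\cdot,k)\in\mathcal{K}$ and $\beta(r,\cdot)$ decreasing with limit $0$. System. $x(k+1)=f(x(k),u(k))+w(k)$, $x(0)=x_0\in\mathbb{R}^n$, with $f:\mathbb{R}^n\times\mathbb{R}^m\to\mathbb{R}^n$ and arbitrary disturbances $w(k)\in\mathbb{R}^n$. $\mathbb{U}\subseteq\mathbb{R}^m$ is the input constraint set (here applied inputs may violate it), $\ell$ is a stage cost with values in $\mathbb{R}_{\ge0}$, and $\mathbb{X}\subseteq\mathbb{R}^n$ is a closed state constraint set. (R) Regularity: there is $\alpha_\ell\in\mathcal{K}_\infty$ with $\ell(x,u)\ge\alpha_\ell(\|x\|+\|u\|)$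 for all $(x,u)\in\mathbb{R}^n\times\mathbb{U}$; $f(0,0)=0$, $\ell(0,0)=0$, $0\in\mathrm{int}(\mathbb{U})$, $0\in\mathrm{int}(\mathbb{X})$; $f,\ell$ are continuous; $\mathbb{U}$ is compact. Nominal MPC. Fix $N\in\mathbb{I}_{\ge1}$. For $x\in\mathbb{R}^n$ and $\mathbf{u}=(\mathbf{u}_0,\dots,\mathbf{u}_{N-1})\in\mathbb{U}^N$, $x_{\mathbf{u}}(k,x)$ is the state after $k$ steps of the undisturbed system ($w\equiv0$) started at $x_{\mathbf{u}}(0,x)=x$. Let $V_{\mathrm{f}}:\mathbb{R}^n\to\mathbb{R}_{\ge0}$ be continuous, $\mathbb{X}_{\mathrm{f}}\subseteq\mathbb{X}$ closed, and $$\mathcal{J}_N(x,\mathbf{u})=\sum_{k=0}^{N-1}\ell(x_{\mathbf{u}}(k,x),\mathbf{u}_k)+V_{\mathrm{f}}(x_{\mathbf{u}}(N,x)).$$ $V_{\mathrm{nom}}(x)$ is the minimum of $\mathcal{J}_N(x,\mathbf{u})$ over $\mathbf{u}\in\mathbb{U}^N$ subject to $x_{\mathbf{u}}(k,x)\in\mathbb{X}$, $k\in\mathbb{I}_{[0,N-1]}$, and $x_{\mathbf{u}}(N,x)\in\mathbb{X}_{\mathrm{f}}$; $\mathbb{X}_N\subseteq\mathbb{X}$ is the set of $x$ for which these constraints are feasible. (T) Terminal conditions: there are $k_{\mathrm{f}}:\mathbb{X}_{\mathrm{f}}\to\mathbb{U}$ and $\alpha_{\mathrm{f}}\in\mathcal{K}_\infty$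 such that for every $x\in\mathbb{X}_{\mathrm{f}}$, with $u=k_{\mathrm{f}}(x)$, $x^+=f(x,u)$: $V_{\mathrm{f}}(x^+)\le V_{\mathrm{f}}(x)-\ell(x,u)$; $(x,u)\in\mathbb{X}\times\mathbb{U}$; $x^+\in\mathbb{X}_{\mathrm{f}}$; $V_{\mathrm{f}}(x)\le\alpha_{\mathrm{f}}(\|x\|)$. Moreover $0\in\mathrm{int}(\mathbb{X}_{\mathrm{f}})$ and $\mathbb{X}_N$ is compact. (IS) Incremental stabilizability: $V_\delta:\mathbb{R}^n\times\mathbb{R}^n\to\mathbb{R}_{\ge0}$ is continuous and there are a control law $\kappa:\mathbb{R}^n\times\mathbb{R}^n\times\mathbb{R}^m\to\mathbb{R}^m$ and $\alpha_{\delta,1},\dots,\alpha_{\delta,4}\in\mathcal{K}_\infty$ such that for all $x,z,w\in\mathbb{R}^n$, $u\in\mathbb{U}$: $\alpha_{\delta,1}(\|x-z\|)\le V_\delta(x,z)\le\alpha_{\delta,2}(\|x-z\|)$ and $V_\delta(f(x,\kappa(x,z,u))+w,f(z,u))-V_\delta(x,z)\le-\alpha_{\delta,3}(\|x-z\|)+\alpha_{\delta,4}(\|w\|)$. (E) Simplifying conditions: (a) $\alpha_\ell(r)=c_\ell r^2$ and $\alpha_{\mathrm{f}}(r)=c_{\mathrm{f}}r^2$ are quadratic; (b) $\ell(x,u)=\|x\|_Q^2+\|u\|_R^2$ with positive definite matrices $Q,R$ (this formula also defines $\ell(x,u)$ for $u\notin\mathbb{U}$); (c) $\alpha_{\delta,i}(r)=c_{\delta,i}r^2$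 are quadratic, $i\in\mathbb{I}_{[1,4]}$. (L) Lipschitz feedback: there is a constant $c_\kappa\ge0$ with $\|\kappa(x,z,v)-v\|\le c_\kappa\|x-z\|$ for all $x\in\mathbb{R}^n$, $z\in\mathbb{X}$, $v\in\mathbb{U}$. Relaxed MPC. For a weight $\lambda>0$, $$V_{\mathrm{slack}}(x)=\min_{\bar{x}\in\mathbb{R}^n,\,\mathbf{u}\in\mathbb{U}^N}\mathcal{J}_N(\bar{x},\mathbf{u})+\lambda V_\delta(x,\bar{x})\quad\text{s.t. }x_{\mathbf{u}}(k,\bar{x})\in\mathbb{X},\ k\in\mathbb{I}_{[0,N-1]},\ x_{\mathbf{u}}(N,\bar{x})\in\mathbb{X}_{\mathrm{f}},$$ with minimizer denoted $(\bar{x}^*_{\mathrm{slack}}(x),\mathbf{u}^*_{\mathrm{slack}}(x))$. The applied input is $\pi_{\mathrm{input}}(x)=\kappa\big(x,\bar{x}^*_{\mathrm{slack}}(x),\mathbf{u}^*_{\mathrm{slack},0}(x)\big)$, where $\mathbf{u}^*_{\mathrm{slack},0}(x)$ is the first element of $\mathbf{u}^*_{\mathrm{slack}}(x)$. ISS. A system $x(k+1)=f_{\mathrm{cl}}(x(k),w(k))$ is ISS if there are $\beta\in\mathcal{KL}$, $\gamma\in\mathcal{K}$ such that for every $x(0)\in\mathbb{R}^n$, every sequence $w(k)\in\mathbb{R}^n$, and every $k\in\mathbb{I}_{\ge0}$: $\|x(k)\|\le\beta(\|x(0)\|,k)+\gamma\big(\max_{j\in\mathbb{I}_{[0,k-1]}}\|w(j)\|\big)$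 (for $k=0$ the last term is $0$). $V:\mathbb{R}^n\to\mathbb{R}_{\ge0}$ is an ISS Lyapunov function if there are $\tilde\alpha_1,\dots,\tilde\alpha_4\in\mathcal{K}_\infty$ with $\tilde\alpha_1(\|x\|)\le V(x)\le\tilde\alpha_2(\|x\|)$ and $V(f_{\mathrm{cl}}(x,w))-V(x)\le-\tilde\alpha_3(\|x\|)+\tilde\alpha_4(\|w\|)$ for all $x,w\in\mathbb{R}^n$. *)

(* Defs.v *)
From HB Require Import structures.
From mathcomp Require Import all_boot all_order all_algebra.
From mathcomp Require Import all_classical all_reals all_analysis.

Set Implicit Arguments.
Unset Strict Implicit.
Unset Printing Implicit Defensive.

Import Order.TTheory GRing.Theory Num.Theory.
Import numFieldNormedType.Exports.

Local Open Scope classical_set_scope.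
Local Open Scope ring_scope.

(* Points of R^n are row vectors, so the quadratic form of Q reads
   x *m Q *m x^T.  The library's `|x| on matrices is the sup norm, whence
   l2norm; both induce the library's topology on 'rV[R]_n. *)

Definition l2norm (R : realType) (n : nat) (x : 'rV[R]_n) : R :=
  Num.sqrt (\sum_(i < n) x 0 i ^+ 2).

Definition qnorm (R : realType) (n : nat) (Q : 'M[R]_n) (x : 'rV[R]_n) : R :=
  Num.sqrt ((x *m Q *m x^T) 0 0).

Definition posdef (R : realType) (n : nat) (Q : 'M[R]_n) : Prop :=
  Q^T = Q /\ forall x : 'rV[R]_n, x != 0 -> 0 < (x *m Q *m x^T) 0 0.

(* For 0 < n and Q symmetric the set of eigenvalues is finite and nonempty, so
   this supremum is the largest eigenvalue. *)
Definition sigma_max (R : realType) (n : nat) (Q : 'M[R]_n) : R :=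
  sup [set a | eigenvalue Q a].

Definition setdist (R : realType) (n : nat) (x : 'rV[R]_n)
    (A : set 'rV[R]_n) : R :=
  inf [set l2norm (x - s) | s in A].

(* Comparison functions have domain [0, +oo[; their values at negative
   arguments are irrelevant. *)

Definition class_K (R : realType) (a : R -> R) : Prop :=
  [/\ {within [set r | 0 <= r], continuous a},
      forall r s, 0 <= r -> r < s -> a r < a s
    & a 0 = 0].

Definition class_Kinfty (R : realType) (a : R -> R) : Prop :=
  class_K a /\ a r @[r --> +oo] --> +oo.

(* b r is nonincreasing rather than strictly decreasing: b 0 is constantly 0. *)
Definition class_KL (R : realType) (b : R -> nat -> R) : Prop :=
  (forall k, class_K (fun r => b r k)) /\
  (forall r, 0 <= r -> nonincreasing_seq (b r) /\ b r @ \oo --> 0).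

Definition quadratic (R : realType) (a : R -> R) (c : R) : Prop :=
  forall r, 0 <= r -> a r = c * r ^+ 2.

Definition ISS (R : realType) (n : nat)
    (fcl : 'rV[R]_n -> 'rV[R]_n -> 'rV[R]_n) : Prop :=
  exists (beta : R -> nat -> R) (gamma : R -> R),
    [/\ class_KL beta, class_K gamma &
        forall x w : nat -> 'rV[R]_n,
          (forall k, x k.+1 = fcl (x k) (w k)) ->
          forall k, l2norm (x k) <= beta (l2norm (x 0%N)) k
            + gamma (\big[Num.max/0]_(j < k) l2norm (w j))].

Definition ISS_Lyapunov (R : realType) (n : nat)
    (fcl : 'rV[R]_n -> 'rV[R]_n -> 'rV[R]_n) (V : 'rV[R]_n -> R) : Prop :=
  exists a1 a2 a3 a4 : R -> R,
    [/\ [/\ class_Kinfty a1, class_Kinfty a2, class_Kinfty a3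
          & class_Kinfty a4],
        forall x, a1 (l2norm x) <= V x <= a2 (l2norm x)
      & forall x w,
          V (fcl x w) - V x <= - a3 (l2norm x) + a4 (l2norm w)].

Definition minimizer (R : realType) (T : Type) (A : set T) (g : T -> R)
    (p : T) : Prop :=
  A p /\ forall q, A q -> g p <= g q.

(* The minimum of g over A, whenever a minimizer exists. *)
Definition minval (R : realType) (T : Type) (A : set T) (g : T -> R) : R :=
  inf [set g p | p in A].

Section MPC.
Variables (R : realType) (n m : nat).
Implicit Types (x z w : 'rV[R]_n) (u v : 'rV[R]_m).

Variables (f : 'rV[R]_n -> 'rV[R]_m -> 'rV[R]_n) (l : 'rV[R]_n -> 'rV[R]_m -> R).
Variables (U : set 'rV[R]_m) (X : set 'rV[R]_n).

(* l is the stage cost on R^n x U, extended arbitrarily to a total function. *)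
Definition regularity (al : R -> R) : Prop :=
  [/\ class_Kinfty al /\
        (forall x u, U u -> 0 <= l x u /\ al (l2norm x + l2norm u) <= l x u),
      f 0 0 = 0 /\ l 0 0 = 0,
      interior U 0 /\ interior X 0,
      continuous (fun p : 'rV[R]_n * 'rV[R]_m => f p.1 p.2) /\
        {within [set: 'rV[R]_n] `*` U,
           continuous (fun p : 'rV[R]_n * 'rV[R]_m => l p.1 p.2)}
    & compact U].

Variable N : nat.

Fixpoint nominal_state (us : N.-tuple 'rV[R]_m) (x : 'rV[R]_n) (k : nat) :
    'rV[R]_n :=
  if k is k'.+1 then f (nominal_state us x k') us`_k' else x.

Variables (Vf : 'rV[R]_n -> R) (Xf : set 'rV[R]_n).

Definition JN x (us : N.-tuple 'rV[R]_m) : R :=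
  \sum_(k < N) l (nominal_state us x k) us`_k + Vf (nominal_state us x N).

Definition feasible x : set (N.-tuple 'rV[R]_m) :=
  [set us : N.-tuple 'rV[R]_m | [/\ forall k, (k < N)%N -> U us`_k,
                forall k, (k < N)%N -> X (nominal_state us x k)
              & Xf (nominal_state us x N)]].

Definition XN : set 'rV[R]_n := [set x | exists us : N.-tuple 'rV[R]_m, feasible x us].

Definition Vnom x : R := minval (feasible x) (JN x).

Definition terminal_conditions (kf : 'rV[R]_n -> 'rV[R]_m) (af : R -> R) :
    Prop :=
  [/\ class_Kinfty af,
      forall x, Xf x ->
        [/\ Vf (f x (kf x)) <= Vf x - l x (kf x),
            X x /\ U (kf x),
            Xf (f x (kf x))
          & Vf x <= af (l2norm x)],
      interior Xf 0
    & compact XN].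

Variables (Vd : 'rV[R]_n -> 'rV[R]_n -> R)
          (kappa : 'rV[R]_n -> 'rV[R]_n -> 'rV[R]_m -> 'rV[R]_m).

Definition incremental_stabilizability (ad1 ad2 ad3 ad4 : R -> R) : Prop :=
  [/\ (forall x z, 0 <= Vd x z) /\
        continuous (fun p : 'rV[R]_n * 'rV[R]_n => Vd p.1 p.2),
      [/\ class_Kinfty ad1, class_Kinfty ad2, class_Kinfty ad3
        & class_Kinfty ad4],
      forall x z, ad1 (l2norm (x - z)) <= Vd x z <= ad2 (l2norm (x - z))
    & forall x z w u, U u ->
        Vd (f x (kappa x z u) + w) (f z u) - Vd x z
          <= - ad3 (l2norm (x - z)) + ad4 (l2norm w)].

Definition lipschitz_feedback (ck : R) : Prop :=
  0 <= ck /\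
  forall x z v, X z -> U v -> l2norm (kappa x z v - v) <= ck * l2norm (x - z).

Definition slack_feasible : set ('rV[R]_n * N.-tuple 'rV[R]_m) :=
  [set p | feasible p.1 p.2].

Definition slack_cost (lam : R) x (p : 'rV[R]_n * N.-tuple 'rV[R]_m) : R :=
  JN p.1 p.2 + lam * Vd x p.1.

Definition Vslack (lam : R) x : R := minval slack_feasible (slack_cost lam x).

(* A selection x |-> (xbar^*_slack(x), u^*_slack(x)) of minimizers. *)
Definition slack_selection (lam : R)
    (sel : 'rV[R]_n -> 'rV[R]_n * N.-tuple 'rV[R]_m) : Prop :=
  forall x, minimizer slack_feasible (slack_cost lam x) (sel x).

Definition pi_input (sel : 'rV[R]_n -> 'rV[R]_n * N.-tuple 'rV[R]_m) x :
    'rV[R]_m :=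
  kappa x (sel x).1 (sel x).2`_0.

Definition closed_loop (sel : 'rV[R]_n -> 'rV[R]_n * N.-tuple 'rV[R]_m)
    (x0 : 'rV[R]_n) (w x : nat -> 'rV[R]_n) (u : nat -> 'rV[R]_m) : Prop :=
  [/\ x 0%N = x0,
      forall k, u k = pi_input sel (x k)
    & forall k, x k.+1 = f (x k) (u k) + w k].

End MPC.

(* Main.v *)
Require Import Defs.
From HB Require Import structures.
From mathcomp Require Import all_boot all_order all_algebra.
From mathcomp Require Import all_classical all_reals all_analysis.
From mathcomp Require Import ring lra.

Set Implicit Arguments.
Unset Strict Implicit.
Unset Printing Implicit Defensive.

Import Order.TTheory GRing.Theory Num.Theory.
Import numFieldNormedType.Exports.

Local Open Scope classical_set_scope.
Local Open Scope ring_scope.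

(** The relaxed value function is a Lyapunov function for the closed loop. Below,
    it is bounded by class K-infinity functions of the nominal initial state z
    and of the mismatch x - z, one of which is at least half as large as x
    (Vslack_lower, class_K_split). Above, the origin is always admissible as
    nominal initial state and has a plan of cost at most 0, so that the value is
    at most lambda ad2(|x|) (Vslack_ad2); this is why the stability is global.
    Along the closed loop, shifting the optimal plan and appending the terminal
    control lowers the nominal cost by the first stage cost (shifted_plan),
    while the feedback kappa lowers the slack penalty by lambda ad3(|x - z|) up
    to lambda ad4(|w|) (Vslack_decrease). Continuity holds because the nominal
    initial states range over a compact set, on which the penalty is
    equicontinuous; existence of minimizers is compactness of the feasible
    plans (feasible_plans_compact).

    That a Lyapunov function yields input-to-state stability (ISS_Lyapunov_ISS)
    is the classical comparison argument. The decrease rate is regularized to a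
    1-Lipschitz function of the value; subtracting half of it is then an
    increasing map below the identity, whose iterates give the class KL bound,
    and the other half absorbs the disturbance outside a sublevel set whose size gives
    the gain.

    For the quadratic bounds, summing the decrease yields the energy estimate
    closed_loop_energy. Constraint violations are at most the deviations from
    the nominal pair, which satisfies the constraints, and the initial value is
    at most a constant plus lambda cd2 times the squared distance to the
    feasible set (constraint_violation_bound). For the performance bound the
    stage cost of the applied pair is compared with the nominal one by Young's
    inequality and the Rayleigh bound by the largest eigenvalue
    (bform_le_sigma_max), with the parameter that makes the remainder equal to
    the slack decrease (performance_bound). *)

(** * Comparison functions *)

(** Continuity on the half line is that of the constant extension to the left, to
    which the calculus of everywhere continuous functions applies. *)
Lemma within_ge0_continuousP (R : realType) (a : R -> R) :
  {within [set r : R | 0 <= r], continuous a} <->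
  continuous (fun r : R => a (Num.max 0 r)).
Proof.
split=> [ca r|ca]; last first.
  apply: (@subspace_eq_continuous R _ R (fun r : R => a (Num.max 0 r)) a).
    by move=> r; rewrite inE /= => r0; rewrite max_r.
  exact: continuous_subspaceT.
have cm : {for r, continuous (fun r : R => Num.max 0 r)}.
  by apply: (@continuous_max R R (fun=> 0) id); [exact: cvg_cst|exact: cvg_id].
move/subspace_continuousP : ca => /(_ (Num.max 0 r)).
rewrite /= le_max lexx => /(_ isT) ca.
apply: (@cvg_comp _ _ _ _ _ _ (within [set r | 0 <= r] (nbhs (Num.max 0 r)))).
  move=> A /cm nA; apply: (@filterS _ (nbhs r) _ _ _ _ nA) => s.
  by apply; rewrite /= le_max lexx.
exact: ca.
Qed.

Lemma class_K_le (R : realType) (a : R -> R) : class_K a ->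
  forall r s, 0 <= r -> r <= s -> a r <= a s.
Proof.
move=> [_ inc _] r s r0; rewrite le_eqVlt => /predU1P[->//|rs].
exact/ltW/inc.
Qed.

Lemma class_K_ge0 (R : realType) (a : R -> R) : class_K a ->
  forall r, 0 <= r -> 0 <= a r.
Proof.
by move=> Ka r r0; case: (Ka) => _ _ a0; rewrite -[leLHS]a0; exact: class_K_le.
Qed.

Lemma class_K_gt0 (R : realType) (a : R -> R) : class_K a ->
  forall r, 0 < r -> 0 < a r.
Proof. by move=> [_ inc a0] r r0; rewrite -[ltLHS]a0; exact: inc. Qed.

Lemma class_K_comp (R : realType) (a b : R -> R) : class_K a -> class_K b ->
  class_K (a \o b).
Proof.
move=> Ka Kb; case: (Ka) (Kb) => ca ia a0 [cb ib b0]; split.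
- apply/within_ge0_continuousP.
  have -> : (fun r => (a \o b) (Num.max 0 r)) =
      (fun s => a (Num.max 0 s)) \o (fun r => b (Num.max 0 r)).
    apply/funext => r /=; rewrite [in RHS]max_r//.
    by apply: class_K_ge0 => //; rewrite le_max lexx.
  move=> r; apply: continuous_comp; first by move/within_ge0_continuousP : cb; apply.
  by move/within_ge0_continuousP : ca; apply.
- by move=> r s r0 rs /=; apply: ia; [exact: class_K_ge0|exact: ib].
- by rewrite /= b0 a0.
Qed.

Lemma class_KD (R : realType) (a b : R -> R) : class_K a -> class_K b ->
  class_K (fun r => a r + b r).
Proof.
move=> [ca ia a0] [cb ib b0]; split.
- apply/within_ge0_continuousP => r.
  by apply: cvgD; [move/within_ge0_continuousP : ca; apply|
                   move/within_ge0_continuousP : cb; apply].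
- by move=> r s r0 rs; apply: ltrD; [exact: ia|exact: ib].
- by rewrite a0 b0 addr0.
Qed.

Lemma class_KZ (R : realType) (c : R) : 0 < c -> class_K (fun r => c * r).
Proof.
move=> c0; split; last by rewrite mulr0.
- by apply: continuous_subspaceT => r; apply: mulrl_continuous.
- by move=> r s _ rs; rewrite ltr_pM2l.
Qed.

Lemma class_K_min (R : realType) (a b : R -> R) : class_K a -> class_K b ->
  class_K (fun r => Num.min (a r) (b r)).
Proof.
move=> [ca ia a0] [cb ib b0]; split.
- apply/within_ge0_continuousP => r.
  have := @continuous_min R R (fun r => a (Num.max 0 r))
    (fun r => b (Num.max 0 r)) r.
  by apply; [move/within_ge0_continuousP : ca; apply|
             move/within_ge0_continuousP : cb; apply].
- move=> r s r0 rs; rewrite lt_min !gt_min ia//= ib// orbT//.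
- by rewrite a0 b0 minxx.
Qed.

Lemma class_Kinfty_min (R : realType) (a b : R -> R) :
  class_Kinfty a -> class_Kinfty b ->
  class_Kinfty (fun r => Num.min (a r) (b r)).
Proof.
move=> [Ka /cvgryPge ay] [Kb /cvgryPge bY]; split; first exact: class_K_min.
by apply/cvgryPge => A; near=> r; rewrite le_min; apply/andP; split; near: r.
Unshelve. all: by end_near. Qed.

Lemma class_Kinfty_scale (R : realType) (c : R) : 0 < c ->
  class_Kinfty (fun r => c * r).
Proof.
move=> c0; split; first exact: class_KZ.
apply/cvgryPge => A; near=> r.
by rewrite -ler_pdivrMl//; near: r; exact: nbhs_pinfty_ge.
Unshelve. all: by end_near. Qed.

Lemma class_Kinfty_comp (R : realType) (a b : R -> R) : class_Kinfty a ->
  class_Kinfty b -> class_Kinfty (a \o b).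
Proof.
move=> [Ka ay] [Kb bY]; split; first exact: class_K_comp.
exact: cvg_comp bY ay.
Qed.

(** Radial unboundedness makes the function onto the half line (intermediate
    values), so an inverse can be chosen; it is continuous because the preimages
    of its order intervals are order intervals. *)
Lemma class_Kinfty_inv (R : realType) (a : R -> R) : class_Kinfty a ->
  exists b, [/\ class_K b, forall r, 0 <= r -> b (a r) = r
                         & forall r, 0 <= r -> a (b r) = r].
Proof.
move=> [Ka /cvgryPge ay]; case: (Ka) => ca ia a0.
have surj v : 0 <= v -> exists r, 0 <= r /\ a r = v.
  move=> v0; have [M [M0 vM]] : exists M, 0 <= M /\ v <= a M.
    near (pinfty_nbhs R) => M; exists M; split.
      by near: M; exact: nbhs_pinfty_ge.
    by near: M; exact: ay.
  have [||c] := @IVT R a 0 M v M0.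
  - have sub : `[0, M]%classic `<=` [set r : R | 0 <= r].
      by move=> r /=; rewrite in_itv /= => /andP[].
    exact: continuous_subspaceW sub ca.
  - by rewrite a0 ge_min v0 /= le_max vM orbT.
  - by rewrite in_itv /= => /andP[c0 _] acv; exists c.
have [b bP] : {b : R -> R & forall v, 0 <= v -> 0 <= b v /\ a (b v) = v}.
  apply: (@choice _ _ (fun v r => 0 <= v -> 0 <= r /\ a r = v)) => v.
  have [/surj[r ?]|//] := boolP (0 <= v); first by exists r.
  by exists 0.
have b_lt v r : 0 <= v -> 0 <= r -> v < a r -> b v < r.
  move=> v0 r0; have [bv0 abv] := bP _ v0; rewrite -{1}abv.
  by apply: contraTT; rewrite -!leNgt => ?; exact: class_K_le.
have b_gt v r : 0 <= v -> 0 <= r -> a r < v -> r < b v.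
  move=> v0 r0; have [bv0 abv] := bP _ v0; rewrite -{1}abv.
  by apply: contraTT; rewrite -!leNgt => ?; exact: class_K_le.
have bK r : 0 <= r -> b (a r) = r.
  move=> r0; have ar0 : 0 <= a r by exact: class_K_ge0.
  have [br0 abr] := bP _ ar0; apply/eqP; case: ltgtP => // H.
    by have := ia _ _ br0 H; rewrite abr ltxx.
  by have := ia _ _ r0 H; rewrite abr ltxx.
exists b; split => //; last by move=> r /bP[].
split.
- apply/subspace_continuousP => v /= v0; have [bv0 abv] := bP _ v0.
  apply/cvgrPdist_lt => e e0; rewrite near_withinE.
  have lo : \forall w \near v, 0 <= w -> b v - e < b w.
    have [be|be] := ltP (b v) e.
      near=> w => w0; apply: (@lt_le_trans _ _ 0); rewrite ?subr_lt0//.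
      by case: (bP _ w0).
    have aev : a (b v - e) < v.
      have : a (b v - e) < a (b v) by apply: ia; rewrite ?subr_ge0// ltrBlDr ltrDl.
      by rewrite abv.
    near=> w => w0; apply: b_gt; rewrite ?subr_ge0//.
    by near: w; exact: lt_nbhsr.
  have hi : \forall w \near v, 0 <= w -> b w < b v + e.
    have aev : a (b v) < a (b v + e) by apply: ia; rewrite // ltrDl.
    rewrite abv in aev.
    near=> w => w0; apply: b_lt; rewrite // ?addr_ge0// 1?ltW//.
    by near: w; exact: lt_nbhsl.
  near=> w => /= w0; rewrite ltr_distlC.
  by rewrite (near lo w)// (near hi w).
- move=> r s r0 rs; have [br0 abr] := bP _ r0.
  by apply: b_gt => //; [rewrite (le_trans r0)// ltW|rewrite abr].
- by rewrite -{1}a0 bK.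
Unshelve. all: by end_near. Qed.

(** * A Lipschitz decrease rate for Lyapunov functions *)

(** An infimal convolution: the largest decrease rate which is 1-Lipschitz in the
    value v of the Lyapunov function and is bounded by a3 at every radius r with
    v <= a2 r. It replaces the usual rate a3 \o a2^-1, for which v minus the
    rate need not be monotone. *)
Definition decay (R : realType) (a2 a3 : R -> R) (v : R) : R :=
  inf [set a3 r + Num.max (v - a2 r) 0 | r in [set r : R | 0 <= r]].

Section Decay.
Variables (R : realType) (a2 a3 : R -> R).
Hypotheses (Ka2 : class_K a2) (Ka3 : class_Kinfty a3).

Local Notation terms v :=
  [set a3 r + Num.max (v - a2 r) 0 | r in [set r : R | 0 <= r]].

Lemma decay_terms_ge0 v : lbound (terms v) 0.
Proof.
move=> _ [r /= r0 <-]; rewrite addr_ge0 ?le_max ?lexx ?orbT//.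
by apply: class_K_ge0 => //; case: Ka3.
Qed.

Lemma decay_terms_inf v : has_inf (terms v).
Proof.
split; last by exists 0; exact: decay_terms_ge0.
by exists (a3 0 + Num.max (v - a2 0) 0), 0 => //=.
Qed.

Lemma decay_ge0 v : 0 <= decay a2 a3 v.
Proof. by apply: lb_le_inf; [case: (decay_terms_inf v)|exact: decay_terms_ge0]. Qed.

Lemma decay_le v r : 0 <= r -> decay a2 a3 v <= a3 r + Num.max (v - a2 r) 0.
Proof.
by move=> r0; apply: ge_inf; [case: (decay_terms_inf v)|exists r].
Qed.

Lemma decay_le_id v : 0 <= v -> decay a2 a3 v <= v.
Proof.
move=> v0; have := @decay_le v 0 (lexx 0).
by case: Ka2 Ka3 => _ _ -> [[_ _ ->] _]; rewrite subr0 add0r max_l.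
Qed.

Lemma decay_homo v w : v <= w -> decay a2 a3 v <= decay a2 a3 w.
Proof.
move=> vw; apply: lb_le_inf; first by case: (decay_terms_inf w).
move=> _ [r /= r0 <-]; apply: le_trans (decay_le v r0) _.
by rewrite lerD2l ge_max !le_max lexx lerD2r vw !orbT.
Qed.

Lemma decay_lip v w : v <= w -> decay a2 a3 w <= decay a2 a3 v + (w - v).
Proof.
move=> vw; rewrite -lerBlDr; apply: lb_le_inf.
  by case: (decay_terms_inf v).
move=> _ [r /= r0 <-]; rewrite lerBlDr; apply: le_trans (decay_le w r0) _.
rewrite -addrA lerD2l ge_max; apply/andP; split.
  have : v - a2 r <= Num.max (v - a2 r) 0 by rewrite le_max lexx.
  lra.
by rewrite addr_ge0 ?subr_ge0// le_max lexx orbT.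
Qed.

(** A slow decay forces a small argument, with a bound of class K. It shows that
    the rate vanishes only at 0, and it yields the gain of the disturbance. *)
Lemma decay_lt_bound b3 v s : (forall r, 0 <= r -> b3 (a3 r) = r) ->
  class_K b3 -> decay a2 a3 v < s -> v <= s + a2 (b3 s).
Proof.
move=> b3K Kb3 vs; case: (Ka3) => Ka3' _.
have [_ [r /= r0 <-] rs] := inf_lt (decay_terms_inf v).1 vs.
have a3r := class_K_ge0 Ka3' r0.
have a3s : a3 r <= s.
  by apply: le_trans (ltW rs); rewrite lerDl le_max lexx orbT.
have vr : v - a2 r <= s.
  apply: le_trans (ltW rs); apply: (@le_trans _ _ (Num.max (v - a2 r) 0)).
    by rewrite le_max lexx.
  by rewrite lerDr.
rewrite -lerBlDr; apply: le_trans vr; rewrite lerB//.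
apply: class_K_le => //; rewrite -[leLHS]b3K//.
exact: class_K_le.
Qed.

Let rho v := v - decay a2 a3 v / 2.

(** Half of the rate is kept to absorb the disturbance; subtracting the other half
    leaves an increasing map because the rate is 1-Lipschitz. *)
Lemma decay_contract_class_K : class_K rho.
Proof.
have d0 : decay a2 a3 0 = 0.
  by apply/eqP; rewrite eq_le decay_ge0 andbT decay_le_id.
split; last by rewrite /rho d0 mul0r subr0.
- apply: continuous_subspaceT => v; apply/cvgrPdist_le => e e0.
  near=> w; apply: (@le_trans _ _ `|v - w|).
    rewrite /rho; have [vw|wv] := leP v w.
      have h1 := decay_homo vw; have h2 := decay_lip vw.
      rewrite !ler0_norm; lra.
    have h1 := decay_homo (ltW wv); have h2 := decay_lip (ltW wv).
    rewrite !ger0_norm; lra.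
  by near: w; apply: cvgr_dist_le e0; exact: cvg_id.
- move=> v w _ vw; have := decay_lip (ltW vw); rewrite /rho; lra.
Unshelve. all: by end_near. Qed.

Lemma decay_contract_iter_le v k : 0 <= v ->
  0 <= iter k.+1 rho v <= iter k rho v.
Proof.
move=> v0; have h j : 0 <= iter j rho v.
  by elim: j => //= j IH; apply: class_K_ge0 IH; exact: decay_contract_class_K.
by rewrite h /= /rho lerBlDr lerDl divr_ge0// decay_ge0.
Qed.

(** The iterates decrease to a limit L. One step from a point close to L removes
    at least half of the rate at L, so that rate is 0 and L = 0. *)
Lemma decay_contract_iter_cvg v : 0 <= v ->
  (fun k => iter k rho v) @ \oo --> 0.
Proof.
move=> v0; pose u k := iter k rho v.
have uP k : 0 <= u k.+1 <= u k by exact: decay_contract_iter_le.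
have ui : nonincreasing_seq u by apply/nonincreasing_seqP => k; case/andP: (uP k).
have u0 k : 0 <= u k by case: k => //= k; case/andP: (uP k).
have lu : has_lbound (range u) by exists 0 => _ [k _ <-].
have uc := nonincreasing_cvgn ui lu; set L := inf _ in uc.
have L0 : 0 <= L.
  apply: lb_le_inf; first by exists (u 0%N), 0%N.
  by move=> _ [k _ <-].
have Lu k : L <= u k by apply: ge_inf => //; exists k.
suff -> : 0 = L by [].
apply/eqP; rewrite eq_le L0 /=.
have dL : decay a2 a3 L <= 0.
  apply/ler_addgt0Pr => e e0; rewrite add0r.
  move: uc => /cvgrPdist_lt /(_ (e / 2)).
  rewrite divr_gt0// => /(_ isT)[k _ /(_ k (leqnn k))].
  rewrite /= ler0_norm ?subr_le0// opprB => ukL.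
  have := Lu k.+1; rewrite /u /= -/(u k) /rho => LSk.
  have := decay_homo (Lu k); lra.
have [b3 [Kb3 b3K _]] := class_Kinfty_inv Ka3.
pose g s := s + a2 (b3 s).
have Kg : class_K g.
  have -> : g = (fun s => 1 * s + (a2 \o b3) s).
    by apply/funext => s; rewrite mul1r.
  by apply: class_KD; [exact: class_KZ|exact: class_K_comp].
case: (Kg) => cg _ g0.
apply/ler_addgt0Pr => e e0; rewrite add0r.
move/subspace_continuousP : cg => /(_ 0 (lexx 0)) /cvgrPdist_lt /(_ e e0).
rewrite near_withinE => /nbhs_ballP[d /= d0 ng].
have s0 : 0 < d / 2 by rewrite divr_gt0.
apply: (@le_trans _ _ (g (d / 2))).
  exact: decay_lt_bound b3K Kb3 (le_lt_trans dL s0).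
have : `|g 0 - g (d / 2)| < e.
  apply: ng; last exact: ltW.
  by rewrite /ball /= sub0r normrN gtr0_norm// ltr_pdivrMr// ltr_pMr// ltr1n.
by rewrite g0 sub0r normrN => /ltW; apply: le_trans; exact: ler_norm.
Qed.

End Decay.

(** * Lyapunov functions yield input-to-state stability *)

Lemma l2norm_ge0 (R : realType) n (x : 'rV[R]_n) : 0 <= l2norm x.
Proof. exact: sqrtr_ge0. Qed.

Lemma class_K_iter (R : realType) (a : R -> R) k : class_K a ->
  class_K (iter k a).
Proof.
move=> Ka; elim: k => [|k IH]; last exact: (class_K_comp Ka IH).
by have := class_KZ (@ltr01 R); congr class_K; apply/funext => r; rewrite mul1r.
Qed.

(** Let rho be the identity minus half of the rate. While the rate is at least
    twice the disturbance level s, the next value is at most the image of the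
    current one under rho; otherwise the current value lies below a class K bound
    in s, and so does the next one. As rho preserves that sublevel set, the
    maximum of the two bounds persists. *)
Theorem ISS_Lyapunov_ISS (R : realType) n
    (fcl : 'rV[R]_n -> 'rV[R]_n -> 'rV[R]_n) (V : 'rV[R]_n -> R) :
  ISS_Lyapunov fcl V -> ISS fcl.
Proof.
move=> [a1 [a2 [a3 [a4 [[Ki1 Ki2 Ki3 Ki4] Vb Vd]]]]].
have [[K1 _] [K2 _] [K3 _] [K4 _]] := And4 Ki1 Ki2 Ki3 Ki4.
have [b1 [Kb1 b1K _]] := class_Kinfty_inv Ki1.
have [b3 [Kb3 b3K _]] := class_Kinfty_inv Ki3.
pose rho v := v - decay a2 a3 v / 2.
have Krho : class_K rho := decay_contract_class_K K2 Ki3.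
pose g s := a2 (b3 (2 * s)) + 3 * s.
have Kg : class_K g.
  apply: class_KD; last exact: class_KZ.
  apply: (class_K_comp K2); apply: (class_K_comp Kb3); exact: class_KZ.
have V0 x : 0 <= V x.
  by case/andP: (Vb x) => + _; apply: le_trans; apply: class_K_ge0; rewrite ?l2norm_ge0.
exists (fun r k => b1 (iter k rho (a2 r))), (fun r => b1 (g (a4 r))); split.
- split=> [k|r r0].
    by apply: (class_K_comp Kb1); apply: (class_K_comp _ K2); exact: class_K_iter.
  have a2r := class_K_ge0 K2 r0; split.
    apply/nonincreasing_seqP => k.
    have /andP[h1 h2] := decay_contract_iter_le K2 Ki3 k a2r.
    exact: class_K_le.
  have cv := decay_contract_iter_cvg K2 Ki3 a2r.
  have [/within_ge0_continuousP cb _ b0] := Kb1.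
  have -> : (fun k => b1 (iter k rho (a2 r))) =
      (fun v => b1 (Num.max 0 v)) \o (fun k => iter k rho (a2 r)).
    apply/funext => k /=; rewrite max_r//.
    by apply: class_K_ge0 a2r; exact: class_K_iter.
  apply: cvg_comp cv _; have := cb 0.
  by rewrite /continuous_at maxxx b0.
- exact: (class_K_comp Kb1 (class_K_comp Kg K4)).
move=> x w xS k; set W := \big[_/_]_(j < k) _; pose s := a4 W.
have W0 : 0 <= W by apply: bigmax_ge_id.
have s0 : 0 <= s by apply: class_K_ge0.
have gs0 : 0 <= g s by apply: class_K_ge0.
(* Either the undisturbed decay still dominates, or the state is already in
   the sublevel set that the disturbance can maintain. *)
have key j : (j <= k)%N -> V (x j) <= iter j rho (V (x 0%N)) \/ V (x j) <= g s.
  elim: j => [|j IH] jk; first by left.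
  have ws : a4 (l2norm (w j)) <= s.
    apply: class_K_le => //; first exact: l2norm_ge0.
    exact: (le_bigmax _ (fun i : 'I_k => l2norm (w i)) (Ordinal jk)).
  set v := V (x j); have v0 : 0 <= v by exact: V0.
  have dv : decay a2 a3 v <= a3 (l2norm (x j)).
    apply: le_trans (decay_le a2 Ki3 v (l2norm_ge0 (x j))) _.
    by rewrite max_r ?addr0// subr_le0; case/andP: (Vb (x j)).
  have vS : V (x j.+1) <= v - decay a2 a3 v + s.
    by have := Vd (x j) (w j); rewrite -xS -/v; lra.
  have [d2s|d2s] := ltP (decay a2 a3 v) (2 * s).
    right; have := decay_lt_bound K2 Ki3 b3K Kb3 d2s.
    by have := decay_ge0 a2 Ki3 v; rewrite /g; lra.
  have vr : V (x j.+1) <= rho v by rewrite /rho; lra.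
  case: (IH (ltnW jk)) => vb; [left|right]; apply: le_trans vr _.
    exact: (class_K_le Krho v0 vb).
  by apply: le_trans _ vb; rewrite /rho lerBlDr lerDl divr_ge0// decay_ge0.
have bV : l2norm (x k) <= b1 (V (x k)).
  rewrite -[leLHS]b1K ?l2norm_ge0//; apply: class_K_le => //.
    by apply: class_K_ge0; rewrite ?l2norm_ge0.
  by case/andP: (Vb (x k)).
have a20 : 0 <= a2 (l2norm (x 0%N)) by apply: class_K_ge0; rewrite ?l2norm_ge0.
have Kit := class_K_iter k Krho.
apply: le_trans bV _; case: (key k (leqnn k)) => Vk.
  rewrite -[leLHS]addr0 lerD//; last exact: class_K_ge0.
  apply: class_K_le => //; apply: le_trans Vk _.
  by apply: class_K_le => //; case/andP: (Vb (x 0%N)).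
rewrite -[leLHS]add0r lerD//; last exact: class_K_le.
by apply: class_K_ge0 => //; exact: class_K_ge0.
Qed.

(** * Compactness of the feasible plans and existence of minimizers *)

Lemma continuous_pair (S T W : topologicalType) (g : S -> T) (h : S -> W) :
  continuous g -> continuous h -> continuous (fun x => (g x, h x)).
Proof.
move=> cg ch x.
have := @cvg_pair _ _ _ (nbhs x) (nbhs (g x)) (nbhs (h x)) _ _ _ _ _ (cg x) (ch x).
by apply.
Qed.

Lemma within_continuous_map (S T W : topologicalType) (A : set S) (B : set T)
    (h : S -> T) (g : T -> W) :
  continuous h -> (forall x, A x -> B (h x)) -> {within B, continuous g} ->
  {within A, continuous (g \o h)}.
Proof.
move=> ch hAB /subspace_continuousP cg; apply/subspace_continuousP => x Ax.
apply: (@cvg_comp _ _ _ _ _ _ (within B (nbhs (h x)))); last exact/cg/hAB.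
move=> C /ch nC; apply: (@filterS _ (nbhs x) _ _ _ _ nC) => y Cy Ay.
exact/Cy/hAB.
Qed.

Lemma minval_minimizer (R : realType) (T : Type) (A : set T) (g : T -> R) p :
  minimizer A g p -> minval A g = g p.
Proof.
move=> [Ap gp]; apply/eqP; rewrite eq_le; apply/andP; split.
  by apply: ge_inf; [exists (g p) => _ [q Aq <-]; exact: gp|exists p].
by apply: lb_le_inf; [exists (g p), p|move=> _ [q Aq <-]; exact: gp].
Qed.

Section Horizon.
Variables (R : realType) (n m : nat).
Variables (f : 'rV[R]_n -> 'rV[R]_m -> 'rV[R]_n) (l : 'rV[R]_n -> 'rV[R]_m -> R).
Variables (U : set 'rV[R]_m) (X : set 'rV[R]_n) (N : nat).
Variables (Vf : 'rV[R]_n -> R) (Xf : set 'rV[R]_n).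
Hypothesis f_cont : continuous (fun p : 'rV[R]_n * 'rV[R]_m => f p.1 p.2).
Hypothesis l_cont : {within [set: 'rV[R]_n] `*` U,
  continuous (fun p : 'rV[R]_n * 'rV[R]_m => l p.1 p.2)}.
Hypothesis Vf_cont : continuous Vf.
Hypotheses (X_closed : closed X) (Xf_closed : closed Xf).
Hypotheses (U_compact : compact U) (XN_compact : compact (XN f U X N Xf)).

(** A nominal initial state with a control sequence, in the product topology, so
    that compactness is Tychonoff's theorem. *)
Definition plans : topologicalType :=
  ('rV[R]_n * prod_topology (fun _ : 'I_N => 'rV[R]_m))%type.

Definition plan_controls (p : plans) : N.-tuple 'rV[R]_m := mktuple p.2.

Definition feasible_plans : set plans :=
  [set p | feasible f U X Xf p.1 (plan_controls p)].

Lemma plan_controls_nth (p : plans) (i : 'I_N) : (plan_controls p)`_i = p.2 i.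
Proof. by rewrite -tnth_nth tnth_mktuple. Qed.

Lemma plan_surj x (us : N.-tuple 'rV[R]_m) :
  exists p : plans, p.1 = x /\ plan_controls p = us.
Proof.
exists (x, tnth us); split => //; apply: eq_from_tnth => i.
by rewrite tnth_mktuple.
Qed.

Lemma plan_control_continuous k : (k < N)%N ->
  continuous (fun p : plans => (plan_controls p)`_k).
Proof.
move=> kN; rewrite (_ : (fun p => _) =
    proj (Ordinal kN) \o (snd : plans -> prod_topology _)).
  move=> p; apply: continuous_comp; first exact: cvg_snd.
  exact: proj_continuous.
by apply/funext => p; exact: (plan_controls_nth p (Ordinal kN)).
Qed.

Lemma plan_state_continuous k : (k <= N)%N ->
  continuous (fun p : plans => nominal_state f (plan_controls p) p.1 k).
Proof.
elim: k => [_|k IH kN] p; first exact: cvg_fst.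
apply: (@continuous_comp _ _ _ (fun p : plans =>
  (nominal_state f (plan_controls p) p.1 k, (plan_controls p)`_k))
  (fun q : 'rV[R]_n * 'rV[R]_m => f q.1 q.2)); last exact: f_cont.
by apply: continuous_pair; [exact: IH (ltnW kN)|exact: plan_control_continuous].
Qed.

Lemma plan_cost_continuous :
  {within feasible_plans, continuous (fun p => JN f l Vf p.1 (plan_controls p))}.
Proof.
move=> p; apply: (@cvgD _ _ (subspace feasible_plans)); last first.
  apply: (@continuous_subspaceT _ _ _
    (fun p : plans => Vf (nominal_state f (plan_controls p) p.1 N))).
  move=> q; apply: continuous_comp; last exact: Vf_cont.
  exact: plan_state_continuous.
move: p; apply: (@continuous_big R 'I_N +%R 0 xpredT (@add_continuous R)
  (subspace feasible_plans) _ (fun (k : 'I_N) p =>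
    l (nominal_state f (plan_controls p) p.1 k) (plan_controls p)`_k)) => k _.
apply: (@within_continuous_map _ _ _ _ _ (fun p : plans =>
  (nominal_state f (plan_controls p) p.1 k, (plan_controls p)`_k))
  (fun q : 'rV[R]_n * 'rV[R]_m => l q.1 q.2) _ _ l_cont).
  apply: continuous_pair; first exact: plan_state_continuous (ltnW (ltn_ord k)).
  exact: plan_control_continuous.
by move=> p [Uk _ _]; split => //=; exact: Uk.
Qed.

(** Feasibility is a closed condition on a product of compact sets, since every
    nominal state depends continuously on the plan. *)
Lemma feasible_plans_compact : compact feasible_plans.
Proof.
pose B : set plans := XN f U X N Xf `*` [set phi | forall i, U (phi i)].
have cB : compact B.
  apply: compact_setX => //.
  exact: (@tychonoff 'I_N (fun _ => 'rV[R]_m) (fun _ => U)).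
pose C : set plans := (\bigcap_(k in [set k | (k < N)%N])
    [set p | X (nominal_state f (plan_controls p) p.1 k)]) `&`
    [set p | Xf (nominal_state f (plan_controls p) p.1 N)].
have clC : closed C.
  apply: closedI; last first.
    apply: (@preimage_closed _ _
      (fun p : plans => nominal_state f (plan_controls p) p.1 N)) => //.
    by move=> p _; exact: plan_state_continuous.
  apply: closed_bigI => k kN.
  apply: (@preimage_closed _ _
    (fun p : plans => nominal_state f (plan_controls p) p.1 k)) => //.
  by move=> p _; apply: plan_state_continuous; exact: ltnW.
rewrite (_ : feasible_plans = B `&` C); first exact: compact_closedI.
apply/seteqP; split=> [p [Up Xp Xfp]|p [[XNp Up] [Xp Xfp]]].
  split; last by split.
  split; first by exists (plan_controls p).
  by move=> i /=; rewrite -plan_controls_nth; exact: Up.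
split => // k kN; have := Up (Ordinal kN).
by rewrite -plan_controls_nth.
Qed.

(** The constraint C on the initial state covers both optimization problems: a
    singleton for the nominal one, the whole space for the relaxed one. *)
Lemma feasible_minimizer (C : set 'rV[R]_n) (g : 'rV[R]_n -> R) :
  closed C -> continuous g ->
  (exists x (us : N.-tuple 'rV[R]_m), C x /\ feasible f U X Xf x us) ->
  exists x (us : N.-tuple 'rV[R]_m), [/\ C x, feasible f U X Xf x us &
    forall y (vs : N.-tuple 'rV[R]_m), C y -> feasible f U X Xf y vs ->
      JN f l Vf x us + g x <= JN f l Vf y vs + g y].
Proof.
move=> clC gc [x0 [us0 [Cx0 feas0]]].
pose A := feasible_plans `&` (fst @^-1` C).
have cA : compact A.
  apply: compact_closedI feasible_plans_compact _.
  by apply: preimage_closed => // p _; exact: cvg_fst.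
have A0 : A !=set0.
  by have [p [p1 pc]] := plan_surj x0 us0; exists p; split; rewrite /feasible_plans /= ?pc ?p1.
have cc : {within A, continuous (fun p : plans =>
    JN f l Vf p.1 (plan_controls p) + g p.1)}.
  move=> p; apply: (@cvgD _ _ (subspace A)).
    by move: p; apply: continuous_subspaceW plan_cost_continuous => p [].
  move: p; apply: (@continuous_subspaceT _ _ _ (fun p : plans => g p.1)).
  by move=> p; apply: continuous_comp; [exact: cvg_fst|exact: gc].
have [p /set_mem[pf pC] pmin] := compact_EVT_min A0 cA cc.
exists p.1, (plan_controls p); split => // y vs Cy yf.
have [q [q1 qc]] := plan_surj y vs.
by have := pmin q; rewrite q1 qc; apply; apply/mem_set; split; rewrite /feasible_plans /= ?qc ?q1.
Qed.

Lemma feasible_cost_bounded : exists2 M : R, 0 <= M &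
  forall x (us : N.-tuple 'rV[R]_m), feasible f U X Xf x us ->
    JN f l Vf x us <= M.
Proof.
have [[p0 fp0]|none] := pselect (feasible_plans !=set0); last first.
  exists 0 => // x us fx; exfalso; apply: none.
  by have [p [p1 pc]] := plan_surj x us; exists p; rewrite /feasible_plans /= p1 pc.
have [|p _ pmax] := compact_EVT_max _ feasible_plans_compact plan_cost_continuous.
  by exists p0.
exists `|JN f l Vf p.1 (plan_controls p)| => // x us fx.
have [q [q1 qc]] := plan_surj x us.
apply: le_trans (ler_norm _); have := pmax q; rewrite q1 qc; apply.
by apply/mem_set; rewrite /feasible_plans /= q1 qc.
Qed.

End Horizon.

(** * Terminal controller and recursive feasibility *)

Section Terminal.
Variables (R : realType) (n m : nat).
Variables (f : 'rV[R]_n -> 'rV[R]_m -> 'rV[R]_n) (l : 'rV[R]_n -> 'rV[R]_m -> R).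
Variables (U : set 'rV[R]_m) (X : set 'rV[R]_n).
Variables (Vf : 'rV[R]_n -> R) (Xf : set 'rV[R]_n) (kf : 'rV[R]_n -> 'rV[R]_m).
Hypothesis terminal : forall x, Xf x ->
  [/\ Vf (f x (kf x)) <= Vf x - l x (kf x), X x /\ U (kf x) & Xf (f x (kf x))].

(** The terminal cost pays for all stages of the terminal controller, by
    telescoping its decrease. *)
Lemma terminal_plan N x : Xf x ->
  exists us : N.-tuple 'rV[R]_m, feasible f U X Xf x us /\ JN f l Vf x us <= Vf x.
Proof.
move=> Xfx; pose traj k := iter k (fun z => f z (kf z)) x.
have Xft k : Xf (traj k) by elim: k => //= k /terminal[].
pose us : N.-tuple 'rV[R]_m := mktuple (fun i : 'I_N => kf (traj i)).
have us_nth k : (k < N)%N -> us`_k = kf (traj k).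
  by move=> kN; rewrite -[k]/(val (Ordinal kN)) -tnth_nth tnth_mktuple.
have st k : (k <= N)%N -> nominal_state f us x k = traj k.
  by elim: k => //= k IH kN; rewrite IH ?us_nth// ltnW.
exists us; split.
  split=> [k kN|k kN|].
  - by rewrite us_nth//; have [_ []] := terminal (Xft k).
  - by rewrite st 1?ltnW//; have [_ []] := terminal (Xft k).
  - by rewrite st.
have cost k : \sum_(j < k) l (traj j) (kf (traj j)) + Vf (traj k) <= Vf x.
  elim: k => [|k IH]; first by rewrite big_ord0 add0r.
  rewrite big_ord_recr /=; apply: le_trans IH.
  by have [H _ _] := terminal (Xft k); rewrite -addrA lerD2l; lra.
rewrite /JN st//; apply: le_trans (cost N); rewrite lerD2r le_eqVlt.
apply/orP; left; apply/eqP; apply: eq_bigr => i _.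
by rewrite st 1?ltnW// us_nth.
Qed.

(** Recursive feasibility: drop the first control and append the terminal one. The
    appended stage cost is paid by the decrease of the terminal cost. *)
Lemma shifted_plan N x (us : N.-tuple 'rV[R]_m) : (0 < N)%N ->
  feasible f U X Xf x us ->
  exists vs : N.-tuple 'rV[R]_m, feasible f U X Xf (f x us`_0) vs /\
    JN f l Vf (f x us`_0) vs <= JN f l Vf x us - l x us`_0.
Proof.
case: N us => // N us _ [Uus Xst Xfst].
set xN := nominal_state f us x N.+1 in Xfst.
have [VfN [XxN UkN] XfN] := terminal Xfst.
pose c k := if (k < N)%N then us`_k.+1 else kf xN.
pose vs : N.+1.-tuple 'rV[R]_m := mktuple (fun i : 'I_N.+1 => c i).
have vs_nth k : (k < N.+1)%N -> vs`_k = c k.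
  by move=> kN; rewrite -[k]/(val (Ordinal kN)) -tnth_nth tnth_mktuple.
have st k : (k <= N)%N ->
    nominal_state f vs (f x us`_0) k = nominal_state f us x k.+1.
  elim: k => //= k IH kN; rewrite IH ?(ltnW kN)// vs_nth ?ltnS ?(ltnW kN)//.
  by rewrite /c kN.
have stN : nominal_state f vs (f x us`_0) N.+1 = f xN (kf xN).
  by rewrite [LHS]/= st// vs_nth// /c ltnn.
exists vs; split.
  split=> [k kN|k kN|]; last by rewrite stN.
  - by rewrite vs_nth// /c; case: ifP => // kN'; exact: Uus.
  - rewrite st//; move: kN; rewrite ltnS leq_eqVlt => /predU1P[->//|kN].
    exact: Xst.
rewrite /JN stN big_ord_recr [X in _ <= X + _ - _]big_ord_recl /=.
rewrite st// vs_nth// /c ltnn -/xN.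
have -> : \sum_(i < N) l (nominal_state f vs (f x us`_0) i) vs`_i =
   \sum_(i < N) l (nominal_state f us x (bump 0 i)) us`_(bump 0 i).
  apply: eq_bigr => i _; rewrite st 1?ltnW// vs_nth; last by rewrite ltnW// ltnS.
  by rewrite /c ltn_ord /bump.
by rewrite -/(nominal_state f us x N.+1) -/xN; lra.
Qed.

End Terminal.

(** * Splitting the Euclidean norm *)

Lemma l2norm_sqr (R : realType) n (x : 'rV[R]_n) :
  l2norm x ^+ 2 = \sum_(i < n) x 0 i ^+ 2.
Proof. by rewrite sqr_sqrtr// sumr_ge0// => i _; exact: sqr_ge0. Qed.

Lemma l2norm0 (R : realType) n : l2norm (0 : 'rV[R]_n) = 0.
Proof.
by rewrite /l2norm big1 ?sqrtr0// => i _; rewrite mxE expr0n.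
Qed.

(** This weak form of the triangle inequality suffices for comparison functions,
    and follows from the pointwise inequality x^2 <= 2 z^2 + 2 (x - z)^2. *)
Lemma l2norm_half (R : realType) n (x z : 'rV[R]_n) :
  l2norm x / 2 <= l2norm z \/ l2norm x / 2 <= l2norm (x - z).
Proof.
have H : l2norm x ^+ 2 <= 2 * l2norm z ^+ 2 + 2 * l2norm (x - z) ^+ 2.
  rewrite !l2norm_sqr !mulr_sumr -big_split /=; apply: ler_sum => i _.
  rewrite !mxE; have := sqr_ge0 (x 0 i - z 0 i - z 0 i); nra.
have [|h1] := leP (l2norm x / 2) (l2norm z); first by left.
have [|h2] := leP (l2norm x / 2) (l2norm (x - z)); first by right.
have := l2norm_ge0 z; have := l2norm_ge0 (x - z); nra.
Qed.

(** The relaxed cost controls the nominal state z and the mismatch x - z; one of the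
    two is at least half as large as x. *)
Lemma class_K_split (R : realType) n (a b : R -> R) (x z : 'rV[R]_n) :
  class_K a -> class_K b ->
  Num.min (a (2^-1 * l2norm x)) (b (2^-1 * l2norm x))
    <= a (l2norm z) + b (l2norm (x - z)).
Proof.
move=> Ka Kb.
have a0 := class_K_ge0 Ka (l2norm_ge0 z).
have b0 := class_K_ge0 Kb (l2norm_ge0 (x - z)).
have x0 : 0 <= 2^-1 * l2norm x by rewrite mulr_ge0// l2norm_ge0.
rewrite ge_min; case: (l2norm_half x z); rewrite mulrC => h; apply/orP.
  by left; have := class_K_le Ka x0 h; lra.
by right; have := class_K_le Kb x0 h; lra.
Qed.

(** * Quadratic forms and distances *)

Definition bform (R : realType) n (Q : 'M[R]_n) (x y : 'rV[R]_n) : R :=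
  (x *m Q *m y^T) 0 0.

Section Forms.
Variables (R : realType) (n : nat).
Implicit Types (Q : 'M[R]_n) (x y a b : 'rV[R]_n).

Lemma bform_sum Q x y :
  bform Q x y = \sum_j \sum_i x 0 i * Q i j * y 0 j.
Proof.
rewrite /bform mxE; apply: eq_bigr => j _; rewrite !mxE mulr_suml.
by apply: eq_bigr => i _.
Qed.

Lemma bformC Q x y : Q^T = Q -> bform Q x y = bform Q y x.
Proof.
move=> Qs; have e : y *m Q *m x^T = (x *m Q *m y^T)^T.
  by rewrite !trmx_mul trmxK Qs mulmxA.
by rewrite /bform e [RHS]mxE.
Qed.

Lemma bformDl Q x y z : bform Q (x + y) z = bform Q x z + bform Q y z.
Proof. by rewrite /bform !mulmxDl mxE. Qed.

Lemma bformZl Q s x y : bform Q (s *: x) y = s * bform Q x y.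
Proof. by rewrite /bform -!scalemxAl mxE. Qed.

Lemma bform_comb Q s t a b : Q^T = Q ->
  bform Q (s *: a + t *: b) (s *: a + t *: b) =
  s ^+ 2 * bform Q a a + 2 * (s * t * bform Q a b) + t ^+ 2 * bform Q b b.
Proof.
move=> Qs; rewrite bformDl !bformZl !(bformC _ (s *: a + _) Qs) !bformDl !bformZl.
by rewrite (bformC b a Qs); ring.
Qed.

Lemma l2norm_bform x : l2norm x ^+ 2 = bform 1%:M x x.
Proof. by rewrite l2norm_sqr /bform mulmx1 mxE; apply: eq_bigr => i _; rewrite mxE. Qed.

Lemma l2norm_sqr_eq0 x : l2norm x ^+ 2 = 0 -> x = 0.
Proof.
move=> /eqP; rewrite l2norm_sqr psumr_eq0 => [/allP x0|i _]; last exact: sqr_ge0.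
apply/rowP => i; rewrite mxE; apply/eqP; rewrite -sqrf_eq0.
by apply: x0; rewrite mem_index_enum.
Qed.

Lemma bform_continuous Q : continuous (fun x => bform Q x x).
Proof.
rewrite (_ : (fun x => bform Q x x) = (fun x => \sum_j \sum_i x 0 i * Q i j * x 0 j)).
  apply: (continuous_big (@add_continuous R)) => j _.
  apply: (continuous_big (@add_continuous R)) => i _ x.
  apply: (@continuousM R _ (fun x => x 0 i * Q i j) (fun x => x 0 j)).
    apply: (@continuousM R _ (fun x => x 0 i) (fun=> Q i j)).
      exact: coord_continuous.
    exact: cst_continuous.
  exact: coord_continuous.
by apply/funext => x; rewrite bform_sum.
Qed.

Lemma l2sphere_compact : compact [set x : 'rV[R]_n | l2norm x ^+ 2 = 1].
Proof.
have cK : compact [set v : 'rV[R]_n | forall i, `[(- 1), 1]%classic (v ord0 i)].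
  by apply: (@rV_compact R n (fun=> `[(- 1), 1]%classic)) => _; exact: segment_compact.
apply: subclosed_compact _ cK _.
  apply: (@preimage_closed _ _ (fun x => l2norm x ^+ 2) [set 1]).
    move=> x _; rewrite (_ : (fun x => _) = (fun x => bform 1%:M x x)).
      exact: bform_continuous.
    by apply/funext => y; rewrite l2norm_bform.
  exact: closed_eq.
move=> x /= x1 i; rewrite in_itv /= -ler_norml -(@expr_le1 _ 2)// real_normK ?num_real//.
rewrite -x1 l2norm_sqr (bigD1 i)//= lerDl.
by apply: sumr_ge0 => j _; exact: sqr_ge0.
Qed.

(** The maximum M of the form over the unit sphere is an eigenvalue: a maximizer is
    isotropic for the positive semidefinite form M - Q, hence in its kernel. *)
Lemma bform_le_sigma_max Q x : (0 < n)%N -> Q^T = Q ->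
  bform Q x x <= sigma_max Q * l2norm x ^+ 2.
Proof.
move=> n_gt0 Qs.
have S0 : [set x : 'rV[R]_n | l2norm x ^+ 2 = 1] !=set0.
  exists (delta_mx 0 (Ordinal n_gt0)) => /=; rewrite l2norm_sqr.
  rewrite (bigD1 (Ordinal n_gt0))//= big1 ?mxE ?eqxx ?addr0 ?expr1n//.
  by move=> i i0; rewrite mxE (negbTE i0) andbF expr0n.
have [v /set_mem /= v1 vmax] := EVT_max_rV S0 l2sphere_compact
  (continuous_subspaceT (@bform_continuous Q)).
set M := bform Q v v in vmax.
have bound y : bform Q y y <= M * l2norm y ^+ 2.
  have [y0|yn0] := eqVneq (l2norm y ^+ 2) 0.
    by rewrite y0 (l2norm_sqr_eq0 y0) mulr0 /bform mul0mx mul0mx mxE.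
  have y2 : 0 < l2norm y ^+ 2 by rewrite lt0r yn0 sqr_ge0.
  pose c := (l2norm y)^-1.
  have yp : l2norm y != 0 by move: yn0; rewrite sqrf_eq0.
  have scal A : A^T = A -> bform A (c *: y) (c *: y) = c ^+ 2 * bform A y y.
    by move=> As; rewrite bformZl bformC// bformZl mulrA -expr2.
  have := vmax (c *: y); rewrite scal// => H.
  rewrite -ler_pdivrMr// mulrC -exprVn; apply: H; apply/mem_set => /=.
  by rewrite l2norm_bform scal ?tr_scalar_mx// -l2norm_bform -exprMn mulVf ?expr1n.
pose B := M%:M - Q.
have Bs : B^T = B by rewrite /B linearB /= tr_scalar_mx Qs.
have BE y z : bform B y z = M * bform 1%:M y z - bform Q y z.
  rewrite /bform /B mulmxBr mulmxBl mul_mx_scalar -scalemxAl mulmx1.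
  by rewrite !mxE.
have B0 y : 0 <= bform B y y by rewrite BE subr_ge0 -l2norm_bform.
have Bv : bform B v v = 0 by rewrite BE -l2norm_bform v1 mulr1 subrr.
pose z := v *m B.
have zz : bform B v z = l2norm z ^+ 2.
  by rewrite l2norm_bform /bform mulmx1.
have z0 : z = 0.
  apply: l2norm_sqr_eq0; apply/eqP; rewrite eq_le sqr_ge0 andbT.
  set s := l2norm z ^+ 2 in zz *.
  set g := bform B z z; have g0 : 0 <= g by exact: B0.
  (* Test the form B at v - t z with t = c s, small enough for the linear
     term -2 t s to dominate the quadratic one t^2 g. *)
  pose c := (g + 1)^-1.
  have cg : c * (g + 1) = 1 by rewrite mulVf// gt_eqF// ltr_wpDl.
  have c0 : 0 < c by rewrite invr_gt0 ltr_wpDl.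
  have := B0 (1 *: v + (- (c * s)) *: z); rewrite bform_comb// Bv zz -/g => H.
  have {}H : 0 <= s ^+ 2 * (c * (c * g - 2)) by move: H; congr (_ <= _); ring.
  have c2 : 0 < c * (2 - c * g) by rewrite mulr_gt0//; lra.
  rewrite leNgt; apply/negP => s0.
  have : 0 < s ^+ 2 * (c * (2 - c * g)) by rewrite mulr_gt0// exprn_gt0.
  move: H; lra.
have vQ : v *m Q = M *: v.
  by apply/esym/eqP; rewrite -subr_eq0 -mul_mx_scalar -mulmxBr; apply/eqP.
have vn0 : v != 0.
  apply: contra_eq_neq v1 => ->; rewrite l2norm0 expr0n /= eq_sym.
  exact: oner_neq0.
have MM : M <= sigma_max Q.
  apply: ub_le_sup; last by apply/eigenvalueP; exists v.
  exists M => a /eigenvalueP[y yQ yn0].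
  have y2 : 0 < l2norm y ^+ 2.
    by rewrite lt0r sqr_ge0 andbT; apply: contra_neq yn0 => /l2norm_sqr_eq0.
  have := bound y; rewrite /bform yQ -scalemxAl mxE.
  by rewrite -[X in (X *m _) 0 0]mulmx1 -/(bform _ _ _) -l2norm_bform ler_pM2r.
by apply: le_trans (bound x) _; rewrite ler_wpM2r// sqr_ge0.
Qed.

End Forms.

Section PositiveForms.
Variables (R : realType) (n : nat) (Q : 'M[R]_n).
Hypothesis Qp : posdef Q.
Implicit Types x z : 'rV[R]_n.

Lemma bform_ge0 x : 0 <= bform Q x x.
Proof.
have [->|/Qp.2/ltW//] := eqVneq x 0.
by rewrite /bform !mul0mx mxE.
Qed.

Lemma qnorm_bform x : qnorm Q x ^+ 2 = bform Q x x.
Proof. by rewrite sqr_sqrtr// bform_ge0. Qed.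

Lemma qnorm_le_sigma_max x : (0 < n)%N ->
  qnorm Q x ^+ 2 <= sigma_max Q * l2norm x ^+ 2.
Proof. by move=> n_gt0; rewrite qnorm_bform; apply: bform_le_sigma_max Qp.1. Qed.

Lemma sigma_max_gt0 : (0 < n)%N -> 0 < sigma_max Q.
Proof.
move=> n_gt0; pose x : 'rV[R]_n := delta_mx 0 (Ordinal n_gt0).
have xn0 : x != 0.
  apply/eqP => /rowP/(_ (Ordinal n_gt0)); rewrite !mxE !eqxx /= => /eqP.
  by rewrite oner_eq0.
have x2 : 0 < l2norm x ^+ 2.
  by rewrite lt0r sqr_ge0 andbT; apply: contra_neq xn0 => /l2norm_sqr_eq0.
by have := lt_le_trans (Qp.2 _ xn0) (bform_le_sigma_max x n_gt0 Qp.1); rewrite pmulr_lgt0.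
Qed.

(** Young's inequality, from the nonnegativity of the form at
    e z - (x - z). *)
Lemma qnorm_young e x z : 0 < e ->
  qnorm Q x ^+ 2 <= (1 + e) * qnorm Q z ^+ 2 + (1 + e^-1) * qnorm Q (x - z) ^+ 2.
Proof.
move=> e0; rewrite !qnorm_bform.
have := bform_ge0 (e *: z + (-1) *: (x - z)); rewrite bform_comb ?Qp.1// => H.
have xE : x = 1 *: z + 1 *: (x - z) by rewrite !scale1r addrC subrK.
rewrite {1 2}xE bform_comb ?Qp.1//.
set A := bform Q z z in H *; set B := bform Q z (x - z) in H *.
set D := bform Q (x - z) (x - z) in H *.
have {}H : 0 <= e^-1 * (e ^+ 2 * A + 2 * (e * -1 * B) + (-1) ^+ 2 * D).
  by rewrite mulr_ge0// invr_ge0 ltW.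
have E : e^-1 * (e ^+ 2 * A + 2 * (e * -1 * B) + (-1) ^+ 2 * D) =
    e * A - 2 * B + e^-1 * D by field; exact: lt0r_neq0.
by rewrite E in H; lra.
Qed.

End PositiveForms.

Section SetDistance.
Variables (R : realType) (n : nat) (A : set 'rV[R]_n).
Implicit Types x s : 'rV[R]_n.

Lemma setdist_le x s : A s -> 0 <= setdist x A <= l2norm (x - s).
Proof.
move=> As; have lb : lbound [set l2norm (x - t) | t in A] 0.
  by move=> _ [t _ <-]; exact: l2norm_ge0.
apply/andP; split; first by apply: lb_le_inf lb; exists (l2norm (x - s)), s.
by apply: ge_inf; [exists 0|exists s].
Qed.

(** Passes from all points of A to the distance without assuming that the
    distance is attained. *)
Lemma le_setdist_sqr x b c : 0 <= c -> A !=set0 ->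
  (forall s, A s -> b <= c * l2norm (x - s) ^+ 2) -> b <= c * setdist x A ^+ 2.
Proof.
move=> c0 [s0 As0] bA; have [b0|b0] := leP b 0.
  by apply: le_trans b0 _; rewrite mulr_ge0// sqr_ge0.
have {}c0 : 0 < c.
  rewrite lt0r c0 andbT; apply/negP => /eqP cE.
  by have := bA _ As0; rewrite cE mul0r leNgt b0.
have bc0 : 0 <= b / c by rewrite divr_ge0 ?ltW.
have sd : Num.sqrt (b / c) <= setdist x A.
  apply: lb_le_inf; first by exists (l2norm (x - s0)), s0.
  move=> _ [s As <-]; rewrite -(@ler_pXn2r _ 2)// ?nnegrE ?sqrtr_ge0 ?l2norm_ge0//.
  by rewrite sqr_sqrtr// ler_pdivrMr// mulrC bA.
have /andP[d0 _] := setdist_le x As0.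
have : Num.sqrt (b / c) ^+ 2 <= setdist x A ^+ 2.
  by rewrite ler_pXn2r// nnegrE sqrtr_ge0.
by rewrite sqr_sqrtr// ler_pdivrMr// mulrC.
Qed.

End SetDistance.

(** * The relaxed value function *)

Section Slack.
Variables (R : realType) (n m : nat).
Variables (f : 'rV[R]_n -> 'rV[R]_m -> 'rV[R]_n) (l : 'rV[R]_n -> 'rV[R]_m -> R).
Variables (U : set 'rV[R]_m) (X : set 'rV[R]_n) (N : nat).
Variables (Vf : 'rV[R]_n -> R) (Xf : set 'rV[R]_n) (kf : 'rV[R]_n -> 'rV[R]_m).
Variables (Vd : 'rV[R]_n -> 'rV[R]_n -> R).
Variables (kappa : 'rV[R]_n -> 'rV[R]_n -> 'rV[R]_m -> 'rV[R]_m).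
Variables (al af ad1 ad2 ad3 ad4 : R -> R).
Hypotheses (X_closed : closed X) (N_gt0 : (0 < N)%N).
Hypotheses (Vf_ge0 : forall x, 0 <= Vf x) (Vf_cont : continuous Vf).
Hypothesis Xf_closed : closed Xf.
Hypothesis reg : regularity f l U X al.
Hypothesis term : terminal_conditions f l U X N Vf Xf kf af.
Hypothesis incr : incremental_stabilizability f U Vd kappa ad1 ad2 ad3 ad4.

Implicit Types (lam : R) (x y z w : 'rV[R]_n).
Implicit Types (sel : 'rV[R]_n -> 'rV[R]_n * N.-tuple 'rV[R]_m).

Local Notation feas := (feasible f U X Xf).
Local Notation J := (JN f l Vf).
Local Notation XN := (XN f U X N Xf).
Local Notation Vs := (Vslack f l U X N Vf Xf Vd).
Local Notation slack_minimizer lam x :=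
  (minimizer (@slack_feasible R n m f U X N Xf) (slack_cost f l Vf Vd lam x)).

Let terminal x : Xf x ->
  [/\ Vf (f x (kf x)) <= Vf x - l x (kf x), X x /\ U (kf x) & Xf (f x (kf x))].
Proof. by case: term => _ H _ _ /H[]. Qed.

Lemma cost_minimizer C (g : 'rV[R]_n -> R) : closed C -> continuous g ->
  (exists x (us : N.-tuple 'rV[R]_m), C x /\ feas x us) ->
  exists x (us : N.-tuple 'rV[R]_m), [/\ C x, feas x us &
    forall y (vs : N.-tuple 'rV[R]_m), C y -> feas y vs ->
      J x us + g x <= J y vs + g y].
Proof.
by case: reg term => _ _ _ [cf cl] cU [_ _ _ cXN]; exact: feasible_minimizer.
Qed.

Lemma cost_bounded : exists2 M : R, 0 <= M &
  forall x (us : N.-tuple 'rV[R]_m), feas x us -> J x us <= M.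
Proof.
by case: reg term => _ _ _ [cf cl] cU [_ _ _ cXN]; exact: feasible_cost_bounded.
Qed.

(** The origin has a plan of nonpositive cost, which as nominal initial state bounds
    the relaxed value by the slack penalty alone, from any state. *)
Lemma origin_plan : exists us : N.-tuple 'rV[R]_m, feas 0 us /\ J 0 us <= 0.
Proof.
case: (term) => -[[_ _ af0] _] tc Xf0 _.
have {}Xf0 : Xf 0 by exact: interior_subset Xf0.
have [us [fus Jus]] := terminal_plan terminal N Xf0.
exists us; split => //; apply: le_trans Jus _.
by case: (tc _ Xf0) => _ _ _; rewrite l2norm0 af0.
Qed.

Lemma nominal_minimizer x : XN x -> exists us : N.-tuple 'rV[R]_m,
  minimizer (feas x) (J x) us.
Proof.
move=> [us0 fus0].
have clx : closed [set x].
  exact/accessible_closed_set1/hausdorff_accessible/norm_hausdorff.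
have c0 : continuous (cst 0 : 'rV[R]_n -> R) by exact: cst_continuous.
have [|x' [us [-> fus usmin]]] := cost_minimizer clx c0.
  by exists x, us0; split.
exists us; split => // vs fvs.
by have := usmin x vs erefl fvs; rewrite !addr0.
Qed.

Lemma slack_minimizer_exists lam x : exists p, slack_minimizer lam x p.
Proof.
have [us0 [fus0 _]] := origin_plan.
have cVd : continuous (fun y => lam * Vd x y).
  move=> y; apply: (@continuous_comp _ _ _ (Vd x) ( *%R lam)); last first.
    exact: mulrl_continuous.
  case: incr => -[_ Vdc] _ _ _.
  apply: (@continuous_comp _ _ _ (fun y => (x, y))
    (fun q : 'rV[R]_n * 'rV[R]_n => Vd q.1 q.2)); last exact: Vdc.
  by apply: continuous_pair; [exact: cst_continuous|move=> ?; exact: cvg_id].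
have [|y [us [_ fus usmin]]] := cost_minimizer closedT cVd.
  by exists 0, us0; split.
by exists (y, us); split => // -[z vs] /= fvs; exact: usmin.
Qed.

Lemma Vslack_le lam x y (us : N.-tuple 'rV[R]_m) : feas y us ->
  Vs lam x <= J y us + lam * Vd x y.
Proof.
move=> fus; have [p pmin] := slack_minimizer_exists lam x.
by rewrite /Vslack (minval_minimizer pmin); case: pmin => _ /(_ (y, us) fus).
Qed.

Lemma Vslack_ad2 lam x : 0 < lam -> Vs lam x <= lam * ad2 (l2norm x).
Proof.
move=> lam0; have [us [fus Jus]] := origin_plan.
apply: le_trans (Vslack_le lam x fus) _; rewrite -[leRHS]add0r lerD//.
rewrite ler_pM2l//; case: incr => _ _ /(_ x 0) + _.
by rewrite subr0 => /andP[].
Qed.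

Lemma stage_le_cost x (us : N.-tuple 'rV[R]_m) : feas x us ->
  al (l2norm x) <= l x us`_0 <= J x us.
Proof.
case: (reg) => -[[Kal _] lge] _ _ _ _ [Uus _ _].
have Uk (k : 'I_N) : 0 <= l (nominal_state f us x k) us`_k.
  by case: (lge (nominal_state f us x k) us`_k (Uus k (ltn_ord k))).
apply/andP; split.
  case: (lge x us`_0 (Uus 0%N N_gt0)) => _; apply: le_trans.
  by apply: class_K_le; rewrite ?l2norm_ge0// lerDl l2norm_ge0.
rewrite /JN (bigD1 (Ordinal N_gt0))//= -addrA lerDl addr_ge0//.
by apply: sumr_ge0 => i _; exact: Uk.
Qed.

Lemma Vslack_lower lam x p : 0 < lam -> slack_minimizer lam x p ->
  al (l2norm p.1) + lam * ad1 (l2norm (x - p.1)) <= Vs lam x.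
Proof.
move=> lam0 pmin; rewrite /Vslack (minval_minimizer pmin) /slack_cost.
case: pmin => /stage_le_cost/andP[h1 h2] _; apply: lerD; first exact: le_trans h2.
by rewrite ler_pM2l//; case: incr => _ _ /(_ x p.1)/andP[].
Qed.

(** The candidate at the successor state is the shifted plan from the successor of
    the nominal state: the nominal cost falls by the first stage cost, and the
    feedback contracts the slack penalty up to the disturbance. *)
Lemma Vslack_decrease lam x w p : 0 < lam -> slack_minimizer lam x p ->
  Vs lam (f x (kappa x p.1 p.2`_0) + w) <=
  Vs lam x - (l p.1 p.2`_0 + lam * ad3 (l2norm (x - p.1)))
  + lam * ad4 (l2norm w).
Proof.
move=> lam0 pmin; rewrite [in leRHS]/Vslack (minval_minimizer pmin) /slack_cost.
case: pmin => fp _; have [vs [fvs Jvs]] := shifted_plan terminal N_gt0 fp.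
apply: le_trans (Vslack_le lam _ fvs) _.
case: incr => _ _ _ /(_ x p.1 w p.2`_0).
have U0 : U p.2`_0 by case: fp => /(_ 0%N N_gt0).
move=> /(_ U0); rewrite -(ler_pM2l lam0); lra.
Qed.

Lemma Vslack_ISS_Lyapunov lam sel : 0 < lam ->
  slack_selection f l U X Vf Xf Vd lam sel ->
  ISS_Lyapunov (fun x w => f x (pi_input kappa sel x) + w) (Vs lam).
Proof.
move=> lam0 selP.
have [_ [Ki1 Ki2 Ki3 Ki4] _ _] := incr; have [[Kal _] _ _ _ _] := reg.
have Klam (a : R -> R) : class_Kinfty a -> class_Kinfty (fun r => lam * a r).
  by move=> Ka; exact: (class_Kinfty_comp (class_Kinfty_scale lam0) Ka).
have Khalf (a : R -> R) : class_Kinfty a -> class_Kinfty (fun r => a (2^-1 * r)).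
  move=> Ka; apply: (class_Kinfty_comp Ka); apply: class_Kinfty_scale.
  by rewrite invr_gt0.
exists (fun r => Num.min (al (2^-1 * r)) (lam * ad1 (2^-1 * r))),
  (fun r => lam * ad2 r),
  (fun r => Num.min (al (2^-1 * r)) (lam * ad3 (2^-1 * r))),
  (fun r => lam * ad4 r); split.
- split; try exact: Klam.
  + apply: class_Kinfty_min; first exact: Khalf.
    exact: (Khalf (fun r => lam * ad1 r) (Klam _ Ki1)).
  + apply: class_Kinfty_min; first exact: Khalf.
    exact: (Khalf (fun r => lam * ad3 r) (Klam _ Ki3)).
- move=> x; rewrite Vslack_ad2// andbT.
  apply: le_trans (Vslack_lower lam0 (selP x)).
  by apply: (@class_K_split _ _ al (fun r => lam * ad1 r)); [case: Kal|case: (Klam _ Ki1)].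
move=> x w; rewrite lerBlDl addrA.
apply: le_trans (Vslack_decrease w lam0 (selP x)) _; rewrite lerD2r lerD2l lerN2.
apply: (@le_trans _ _ (al (l2norm (sel x).1) + lam * ad3 (l2norm (x - (sel x).1)))).
  by apply: (@class_K_split _ _ al (fun r => lam * ad3 r)); [case: Kal|case: (Klam _ Ki3)].
by rewrite lerD2r; have /andP[] := stage_le_cost (selP x).1.
Qed.

Lemma Vslack_continuous lam : 0 < lam -> continuous (Vs lam).
Proof.
move=> lam0 x; apply/(@cvgrPdist_le _ _ _ (nbhs x)) => e e0.
have XNc : compact XN by case: term.
have Vdc : continuous (fun q : 'rV[R]_n * 'rV[R]_n => Vd q.1 q.2).
  by case: incr => -[].
have d0 : 0 < e / lam / 2 by rewrite !divr_gt0.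
(* The slack penalty is equicontinuous over the compact set of nominal
   initial states, so both minima move by at most e. *)
have unif : \forall y \near x, XN `<=`
    [set z | `|Vd x z - Vd y z| <= e / lam].
  apply: ((compact_near_coveringP XN).1 XNc _ (nbhs x)
    (fun y z => `|Vd x z - Vd y z| <= e / lam)) => z XNz.
  have /cvgrPdist_lt /(_ _ d0) Vdz := Vdc (x, z).
  have n1 : \forall z' \near z & y \near x, `|Vd x z - Vd y z'| < e / lam / 2.
    case: Vdz => -[A B] /= [xA zB] AB.
    by exists (B, A) => // -[z' y] [/= Bz' Ay]; apply: (AB (y, z')).
  have n2 : \forall z' \near z & y \near x, `|Vd x z - Vd x z'| < e / lam / 2.
    case: Vdz => -[A B] /= [xA zB] AB.
    exists (B, setT) => /=; first by split => //; exact: filterT.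
    move=> [z' y] [/= Bz' _]; apply: (AB (x, z')); split => //=.
    exact: nbhs_singleton.
  apply: filterS2 n1 n2 => -[z' y] /= h1 h2.
  have -> : Vd x z' - Vd y z' = (Vd x z - Vd y z') - (Vd x z - Vd x z') by ring.
  by apply: le_trans (ler_normB _ _) _; rewrite [leRHS]splitr lerD// ltW.
near=> y.
have close z : XN z -> `|lam * Vd x z - lam * Vd y z| <= e.
  move=> XNz; rewrite -mulrBr normrM gtr0_norm// -ler_pdivlMl// mulrC.
  by have := near unif y; apply.
have half a b : (forall z, XN z -> lam * Vd a z <= lam * Vd b z + e) ->
    Vs lam a <= Vs lam b + e.
  move=> ab; have [p pmin] := slack_minimizer_exists lam b.
  rewrite [in leRHS]/Vslack (minval_minimizer pmin) /slack_cost -addrA.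
  have fp := pmin.1; apply: le_trans (Vslack_le lam a fp) _.
  by rewrite lerD2l ab//; exists p.2.
rewrite ler_distl; apply/andP; split.
  rewrite lerBlDr; apply: half => z /close; rewrite ler_distl => /andP[]; lra.
by apply: half => z /close; rewrite ler_distl => /andP[]; lra.
Unshelve. all: by end_near. Qed.

Lemma Vslack_ge0 lam x : 0 < lam -> 0 <= Vs lam x.
Proof.
move=> lam0; have [p pmin] := slack_minimizer_exists lam x.
apply: le_trans (Vslack_lower lam0 pmin); have [[[Kal _] _] _ _ _ _] := reg.
have [_ [[K1 _] _ _ _] _ _] := incr.
by rewrite addr_ge0 ?mulr_ge0// ?(ltW lam0)// class_K_ge0// l2norm_ge0.
Qed.

Lemma Vslack_le_Vnom lam x : 0 < lam -> XN x ->
  Vs lam x <= Vnom f l U X N Vf Xf x.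
Proof.
move=> lam0 XNx; have [us usmin] := nominal_minimizer XNx.
rewrite /Vnom (minval_minimizer usmin); case: usmin => fus _.
apply: le_trans (Vslack_le lam x fus) _; rewrite gerDl.
have [_ [_ [[_ _ ad20] _] _ _] /(_ x x) + _] := incr.
by rewrite subrr l2norm0 ad20 => /andP[_]; rewrite pmulr_rle0.
Qed.

(** Vslack_decrease telescopes, and the final value is nonnegative. *)
Lemma closed_loop_energy lam sel x0 (w x : nat -> 'rV[R]_n) u T : 0 < lam ->
  slack_selection f l U X Vf Xf Vd lam sel ->
  closed_loop f kappa sel x0 w x u ->
  \sum_(k < T) (l (sel (x k)).1 (sel (x k)).2`_0
                + lam * ad3 (l2norm (x k - (sel (x k)).1)))
    <= Vs lam x0 + lam * \sum_(k < T) ad4 (l2norm (w k)).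
Proof.
move=> lam0 selP [x0E uE xE].
suff H : \sum_(k < T) (l (sel (x k)).1 (sel (x k)).2`_0
                + lam * ad3 (l2norm (x k - (sel (x k)).1))) + Vs lam (x T)
    <= Vs lam x0 + lam * \sum_(k < T) ad4 (l2norm (w k)).
  by apply: le_trans H; rewrite lerDl Vslack_ge0.
elim: T => [|T IH]; first by rewrite !big_ord0 x0E mulr0 add0r addr0.
rewrite !big_ord_recr /=.
have := Vslack_decrease (w T) lam0 (selP (x T)).
rewrite -/(pi_input kappa sel (x T)) -uE -xE; lra.
Qed.

Section Quadratic.
Variables (cd2 cd3 cd4 ck : R).
Hypotheses (q2 : quadratic ad2 cd2) (q3 : quadratic ad3 cd3).
Hypotheses (q4 : quadratic ad4 cd4) (lip : lipschitz_feedback U X kappa ck).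

Let class_Kinfty_quadratic_gt0 (a : R -> R) c :
  class_Kinfty a -> quadratic a c -> 0 < c.
Proof.
move=> [Ka _] qa; have := class_K_gt0 Ka (@ltr01 R).
by rewrite qa// expr1n mulr1.
Qed.

Let cd2_gt0 : 0 < cd2.
Proof. by case: incr => _ [_ K _ _] _ _; exact: class_Kinfty_quadratic_gt0 q2. Qed.

Let cd3_gt0 : 0 < cd3.
Proof. by case: incr => _ [_ _ K _] _ _; exact: class_Kinfty_quadratic_gt0 q3. Qed.

Let cd4_gt0 : 0 < cd4.
Proof. by case: incr => _ [_ _ _ K] _ _; exact: class_Kinfty_quadratic_gt0 q4. Qed.

Lemma feedback_deviation lam sel x :
  slack_selection f l U X Vf Xf Vd lam sel ->
  [/\ X (sel x).1, U (sel x).2`_0 &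
      l2norm (pi_input kappa sel x - (sel x).2`_0) <= ck * l2norm (x - (sel x).1)].
Proof.
move=> /(_ x)[[Uus Xst _] _].
have X0 : X (sel x).1 by exact: (Xst 0%N N_gt0).
have U0 : U (sel x).2`_0 by exact: Uus.
by split => //; apply: lip.2.
Qed.

Lemma closed_loop_deviation lam sel x0 (w x : nat -> 'rV[R]_n) u T : 0 < lam ->
  slack_selection f l U X Vf Xf Vd lam sel ->
  closed_loop f kappa sel x0 w x u ->
  lam * cd3 * \sum_(k < T) l2norm (x k - (sel (x k)).1) ^+ 2
    <= Vs lam x0 + lam * cd4 * \sum_(k < T) l2norm (w k) ^+ 2.
Proof.
move=> lam0 selP cl; have := closed_loop_energy T lam0 selP cl.
rewrite big_split /= => H.
have l0 : 0 <= \sum_(k < T) l (sel (x k)).1 (sel (x k)).2`_0.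
  apply: sumr_ge0 => k _; have [_ U0 _] := feedback_deviation (x k) selP.
  by case: reg => -[_ /(_ (sel (x k)).1 _ U0)[]].
have e3 : \sum_(k < T) lam * ad3 (l2norm (x k - (sel (x k)).1)) =
    lam * cd3 * \sum_(k < T) l2norm (x k - (sel (x k)).1) ^+ 2.
  by rewrite mulr_sumr; apply: eq_bigr => k _; rewrite q3 ?l2norm_ge0// mulrA.
have e4 : lam * \sum_(k < T) ad4 (l2norm (w k)) =
    lam * cd4 * \sum_(k < T) l2norm (w k) ^+ 2.
  rewrite -mulrA [cd4 * _]mulr_sumr; congr (_ * _); apply: eq_bigr => k _.
  by rewrite q4 ?l2norm_ge0.
move: H; rewrite e3 e4; lra.
Qed.

(** Any feasible nominal initial state is admissible in the relaxed problem, in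
    particular those nearly closest to x. *)
Lemma Vslack_setdist lam M x : 0 < lam ->
  (forall y (us : N.-tuple 'rV[R]_m), feas y us -> J y us <= M) ->
  Vs lam x <= M + lam * cd2 * setdist x XN ^+ 2.
Proof.
move=> lam0 JM; rewrite addrC -lerBlDr; apply: le_setdist_sqr.
- by rewrite mulr_ge0// ltW.
- by have [us [fus _]] := origin_plan; exists 0, us.
move=> z [us fus]; rewrite lerBlDr addrC; apply: le_trans (Vslack_le lam x fus) _.
rewrite lerD ?JM// -mulrA ler_pM2l// -q2 ?l2norm_ge0//.
by case: incr => _ _ /(_ x z)/andP[].
Qed.

(** The nominal initial state and first control satisfy the constraints, so the
    violations are at most the deviations from them. The energy estimate bounds
    the deviations with weight lambda; dividing by lambda leaves constants
    independent of it. *)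
Lemma constraint_violation_bound : exists c1 c2 c3 : R,
  [/\ 0 <= c1, 0 <= c2, 0 <= c3 &
    forall lam, 0 < lam -> forall sel,
    slack_selection f l U X Vf Xf Vd lam sel ->
    forall x0 (w x : nat -> 'rV[R]_n) u, closed_loop f kappa sel x0 w x u -> forall T,
      \sum_(k < T) (setdist (x k) X ^+ 2 + setdist (u k) U ^+ 2)
        <= c1 * setdist x0 XN ^+ 2 + c2 / lam
           + c3 * \sum_(k < T) l2norm (w k) ^+ 2].
Proof.
have [M M0 JM] := cost_bounded; pose c := (1 + ck ^+ 2) / cd3.
have ck2 : 0 < 1 + ck ^+ 2 by rewrite ltr_wpDr// sqr_ge0.
have c0 : 0 <= c by rewrite divr_ge0// ltW.
exists (c * cd2), (c * M), (c * cd4); split; try by rewrite mulr_ge0// ltW.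
move=> lam lam0 sel selP x0 w x u cl T.
have dev := closed_loop_deviation T lam0 selP cl.
have Vx0 := Vslack_setdist x0 lam0 JM.
set D := \sum_(k < T) l2norm (x k - _) ^+ 2 in dev.
set W := \sum_(k < T) l2norm (w k) ^+ 2 in dev *.
set d := setdist x0 XN ^+ 2 in Vx0 *.
have viol : \sum_(k < T) (setdist (x k) X ^+ 2 + setdist (u k) U ^+ 2)
    <= (1 + ck ^+ 2) * D.
  rewrite mulr_sumr; apply: ler_sum => k _; rewrite mulrDl mul1r -exprMn.
  have [Xz Uv uv] := feedback_deviation (x k) selP; case: cl => _ uE _.
  have /andP[x1 x2] := setdist_le (x k) Xz; have /andP[u1 u2] := setdist_le (u k) Uv.
  apply: lerD; first by rewrite ler_pXn2r ?nnegrE ?l2norm_ge0.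
  rewrite ler_pXn2r// ?nnegrE ?mulr_ge0 ?l2norm_ge0//; last by case: lip.
  by apply: le_trans u2 _; rewrite uE.
apply: le_trans viol _.
have DE : cd3 * D <= cd2 * d + M / lam + cd4 * W.
  rewrite -(ler_pM2l lam0); apply: (@le_trans _ _ (M + lam * cd2 * d + lam * cd4 * W)).
    by move: dev Vx0; lra.
  rewrite le_eqVlt; apply/orP; left; apply/eqP; field; exact: lt0r_neq0.
rewrite [leLHS](_ : _ = c * (cd3 * D)); last by rewrite /c; field; exact: lt0r_neq0.
rewrite [leRHS](_ : _ = c * (cd2 * d + M / lam + cd4 * W)); last by ring.
exact: ler_wpM2l.
Qed.

Variables (Q : 'M[R]_n) (Rw : 'M[R]_m).
Hypotheses (n_gt0 : (0 < n)%N) (m_gt0 : (0 < m)%N).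
Hypotheses (Qp : posdef Q) (Rp : posdef Rw).
Hypothesis lE : forall x u, l x u = qnorm Q x ^+ 2 + qnorm Rw u ^+ 2.

Lemma suboptimality_gt0 lam : 0 < lam ->
  0 < lam^-1 * ((sigma_max Q + ck ^+ 2 * sigma_max Rw) / cd3).
Proof.
move=> lam0; have sQ := sigma_max_gt0 Qp n_gt0; have sR := sigma_max_gt0 Rp m_gt0.
rewrite mulr_gt0 ?invr_gt0// divr_gt0// ltr_wpDr// mulr_ge0 ?sqr_ge0//.
exact: ltW.
Qed.

(** Young's inequality with parameter e compares the stage cost at the actual state
    and input with that of the nominal pair; e is the value for which the
    remainder is exactly the slack decrease lambda cd3 |x - z|^2. *)
Lemma performance_bound lam sel x0 (w x : nat -> 'rV[R]_n) u T : 0 < lam ->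
  slack_selection f l U X Vf Xf Vd lam sel -> XN x0 ->
  closed_loop f kappa sel x0 w x u ->
  (1 + lam^-1 * ((sigma_max Q + ck ^+ 2 * sigma_max Rw) / cd3))^-1 *
    \sum_(k < T) l (x k) (u k)
  <= Vnom f l U X N Vf Xf x0 + lam * cd4 * \sum_(k < T) l2norm (w k) ^+ 2.
Proof.
move=> lam0 selP XNx0 cl; set e := lam^-1 * _.
have e0 : 0 < e := suboptimality_gt0 lam0.
have e1 : 0 < 1 + e by lra.
have sR := sigma_max_gt0 Rp m_gt0.
have stage k : l (x k) (u k) <= (1 + e) *
    (l (sel (x k)).1 (sel (x k)).2`_0
     + lam * ad3 (l2norm (x k - (sel (x k)).1))).
  have [_ _ uv] := feedback_deviation (x k) selP; case: (cl) => _ uE _.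
  rewrite -uE in uv; set z := (sel (x k)).1 in uv *.
  set v := (sel (x k)).2`_0 in uv *; set r := l2norm (x k - z) in uv *.
  rewrite q3 ?l2norm_ge0// !lE.
  have yQ := qnorm_young Qp (x k) z e0; have yR := qnorm_young Rp (u k) v e0.
  have bQ := qnorm_le_sigma_max Qp (x k - z) n_gt0; rewrite -/r in bQ.
  have bR := qnorm_le_sigma_max Rp (u k - v) m_gt0.
  have bR' : qnorm Rw (u k - v) ^+ 2 <= sigma_max Rw * (ck ^+ 2 * r ^+ 2).
    apply: le_trans bR _; rewrite ler_pM2l// -exprMn ler_pXn2r ?nnegrE ?l2norm_ge0//.
    by rewrite mulr_ge0 ?l2norm_ge0//; case: lip.
  have ie : 0 <= 1 + e^-1 by rewrite addr_ge0// invr_ge0 ltW.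
  have key : (1 + e^-1) * (sigma_max Q * r ^+ 2 + sigma_max Rw * (ck ^+ 2 * r ^+ 2))
      = (1 + e) * (lam * (cd3 * r ^+ 2)).
    have eE : sigma_max Q + ck ^+ 2 * sigma_max Rw = e * (lam * cd3).
      by rewrite /e; field; rewrite !lt0r_neq0.
    transitivity ((1 + e^-1) * ((sigma_max Q + ck ^+ 2 * sigma_max Rw) * r ^+ 2)).
      by ring.
    by rewrite eE; field; exact: lt0r_neq0.
  rewrite mulrDr -key.
  have := ler_wpM2l ie (lerD bQ bR'); lra.
rewrite ler_pdivrMl//; apply: (@le_trans _ _ ((1 + e) *
  \sum_(k < T) (l (sel (x k)).1 (sel (x k)).2`_0
                + lam * ad3 (l2norm (x k - (sel (x k)).1))))).
  by rewrite mulr_sumr; apply: ler_sum => k _.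
rewrite ler_pM2l//; apply: le_trans (closed_loop_energy T lam0 selP cl) _.
rewrite lerD ?Vslack_le_Vnom// -mulrA [cd4 * _]mulr_sumr ler_pM2l//.
by apply: ler_sum => k _; rewrite q4 ?l2norm_ge0.
Qed.

End Quadratic.

End Slack.

(** * Stability, constraint violation and performance of the relaxed scheme *)

Theorem theorem6 (R : realType) (n m : nat) (n_gt0 : (0 < n)%N)
    (m_gt0 : (0 < m)%N)
    (f : 'rV[R]_n -> 'rV[R]_m -> 'rV[R]_n) (l : 'rV[R]_n -> 'rV[R]_m -> R)
    (U : set 'rV[R]_m) (X : set 'rV[R]_n) (X_closed : closed X)
    (N : nat) (N_gt0 : (0 < N)%N)
    (Vf : 'rV[R]_n -> R) (Vf_ge0 : forall x, 0 <= Vf x)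
    (Vf_continuous : continuous Vf)
    (Xf : set 'rV[R]_n) (Xf_sub : Xf `<=` X) (Xf_closed : closed Xf)
    (kf : 'rV[R]_n -> 'rV[R]_m)
    (Vd : 'rV[R]_n -> 'rV[R]_n -> R)
    (kappa : 'rV[R]_n -> 'rV[R]_n -> 'rV[R]_m -> 'rV[R]_m)
    (al af ad1 ad2 ad3 ad4 : R -> R)
    (reg : regularity f l U X al)
    (term : terminal_conditions f l U X N Vf Xf kf af)
    (incr : incremental_stabilizability f U Vd kappa ad1 ad2 ad3 ad4) :
  [/\ (forall x, XN f U X N Xf x ->
         exists us : N.-tuple 'rV[R]_m,
           minimizer (feasible f U X Xf x) (JN f l Vf x) us),
      (forall (lam : R) x, 0 < lam ->
         exists p : 'rV[R]_n * N.-tuple 'rV[R]_m,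
           minimizer (slack_feasible f U X Xf) (slack_cost f l Vf Vd lam x) p),
      (forall lam : R, 0 < lam ->
         forall sel : 'rV[R]_n -> 'rV[R]_n * N.-tuple 'rV[R]_m,
         slack_selection f l U X Vf Xf Vd lam sel ->
         let fcl x w := f x (pi_input kappa sel x) + w in
         [/\ ISS fcl,
             continuous (Vslack f l U X N Vf Xf Vd lam)
           & ISS_Lyapunov fcl (Vslack f l U X N Vf Xf Vd lam)])
    & forall (cl cf cd1 cd2 cd3 cd4 ck : R) (Q : 'M[R]_n) (Rw : 'M[R]_m),
        quadratic al cl -> quadratic af cf ->
        posdef Q -> posdef Rw ->
        (forall x u, l x u = qnorm Q x ^+ 2 + qnorm Rw u ^+ 2) ->
        quadratic ad1 cd1 -> quadratic ad2 cd2 ->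
        quadratic ad3 cd3 -> quadratic ad4 cd4 ->
        lipschitz_feedback U X kappa ck ->
        (exists c1 c2 c3 : R,
          [/\ 0 <= c1, 0 <= c2, 0 <= c3 &
            forall lam : R, 0 < lam ->
            forall sel : 'rV[R]_n -> 'rV[R]_n * N.-tuple 'rV[R]_m,
            slack_selection f l U X Vf Xf Vd lam sel ->
            forall x0 w x u, closed_loop f kappa sel x0 w x u ->
            forall T : nat,
              \sum_(k < T) (setdist (x k) X ^+ 2 + setdist (u k) U ^+ 2)
                <= c1 * setdist x0 (XN f U X N Xf) ^+ 2 + c2 / lam
                   + c3 * \sum_(k < T) l2norm (w k) ^+ 2])
        /\
        (forall lam : R, 0 < lam ->
          let eps :=
            lam^-1 * ((sigma_max Q + ck ^+ 2 * sigma_max Rw) / cd3) in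
          0 < eps /\
          forall sel : 'rV[R]_n -> 'rV[R]_n * N.-tuple 'rV[R]_m,
          slack_selection f l U X Vf Xf Vd lam sel ->
          forall x0 w x u, XN f U X N Xf x0 ->
          closed_loop f kappa sel x0 w x u ->
          forall T : nat,
            (1 + eps)^-1 * \sum_(k < T) l (x k) (u k)
              <= Vnom f l U X N Vf Xf x0
                 + lam * cd4 * \sum_(k < T) l2norm (w k) ^+ 2)].
Proof.
split.
- exact: (nominal_minimizer X_closed Vf_continuous Xf_closed reg term).
- move=> lam x _.
  exact: (slack_minimizer_exists X_closed Vf_continuous Xf_closed reg term incr).
- move=> lam lam0 sel selP fcl.
  have Lyap := Vslack_ISS_Lyapunov X_closed N_gt0 Vf_ge0 Vf_continuous Xf_closed
    reg term incr lam0 selP.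
  split => //; first exact: (ISS_Lyapunov_ISS Lyap).
  exact: (Vslack_continuous X_closed Vf_continuous Xf_closed reg term incr lam0).
move=> cl cf cd1 cd2 cd3 cd4 ck Q Rw _ _ Qp Rp lE _ q2 q3 q4 lip; split.
  exact: (constraint_violation_bound X_closed N_gt0 Vf_ge0 Vf_continuous
    Xf_closed reg term incr q2 q3 q4 lip).
move=> lam lam0 eps; split.
  exact: (suboptimality_gt0 incr ck q3 n_gt0 m_gt0 Qp Rp lam0).
move=> sel selP x0 w x u XNx0 cloop T.
exact: (performance_bound X_closed N_gt0 Vf_ge0 Vf_continuous Xf_closed reg term
  incr q3 q4 lip n_gt0 m_gt0 Qp Rp lE T lam0 selP XNx0 cloop).
Qed.
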